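(* Suppose that $(X,T)$ has the transitively-convex-saturated property and the entropy-dense property. If $(X,T)$ is not uniquely ergodic and there is an invariant measure with full support, then the ordered collection $\{\emptyset,\ QR\cap BR_1,\ BR_1,\ BR_2,\ BR_3,\ BR_4,\ BR_5\}$ has full entropy gaps with respect to $Tran$.
   Context: $X$ is a compact metric space with metric $d$ and $T:X\to X$ is continuous. $M(T,X)$ is the set of $T$-invariant Borel probability measures with the weak$^*$ topology; $S_\mu$ is the support of $\mu$ (full support: $S_\mu=X$) and $h_\mu=h_\mu(T)$ its metric entropy. $(X,T)$ is uniquely ergodic if $M(T,X)$ is a singleton. For $x\in X$, $\omega_T(x)$ is the $\omega$-limit set and $M_x$ is the set of weak$^*$ limit points of $\frac1n\sum_{j=0}^{n-1}\delta_{T^jx}$. $Tran=\{x:\omega_T(x)=X\}$. Topological entropy of $E\subseteq X$ (Bowen): let $B_n(x,\varepsilon)=\{y: d(T^jx,T^jy)\le\varepsilon,\ 0\le j\le n-1\}$; $\mathfrak F_n(E,\varepsilon)$ is the collection of finite or countable covers of $E$ by sets $B_m(x,\varepsilon)$ with $m\ge n$; $C(E;t,n,\varepsilon,T)=\inf\{\sum_{B_m(x,\varepsilon)\in\mathcal C}2^{-tm}:\mathcal C\in\mathfrak F_n(E,\varepsilon)\}$; $C(E;t,\varepsilon,T)=\lim_{n}C(E;t,n,\varepsilon,T)$; $h_{top}(E,\varepsilon,T)=\inf\{t\ge0:C(E;t,\varepsilon,T)=0\}$; $h_{top}(T,E)=\lim_{\varepsilon\to0}h_{top}(E,\varepsilon,T)$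 (so $h_{top}(T,\emptyset)=0$). Metric entropy uses the same logarithm base $2$. $T$ is transitively-convex-saturated if for every nonempty compact connected $K\subseteq M(T,X)$ contained in the convex hull of finitely many invariant measures, $G^T_K:=\{x\in Tran:M_x=K\}\neq\emptyset$ and $h_{top}(T,G^T_K)=\inf\{h_\mu(T):\mu\in K\}$. $T$ has the entropy-dense property if for every $\mu\in M(T,X)$, every neighbourhood $G$ of $\mu$ in the space of probability measures on $X$ and every $\eta>0$ there is a closed $T$-invariant set $\Lambda\subseteq X$ such that every $T$-invariant probability measure supported on $\Lambda$ lies in $G$ and $h_{top}(T,\Lambda)>h_\mu-\eta$. Full entropy gaps: an ordered collection $Z_1,\dots,Z_k\subseteq X$ ($k\ge2$) has full entropy gaps with respect to $Y\subseteq X$ if $h_{top}(T,(Z_{i+1}\setminus Z_i)\cap Y)=h_{top}(T,Y)$ for all $1\le i<k$. Recurrence: for $S\subseteq\mathbb N$ the upper density is $\bar d(S)=\limsup_n\frac1n|S\cap\{0,\dots,n-1\}|$ and the Banach upper density is $B^*(S)=\limsup_{|I|\to\infty}|S\cap I|/|I|$ over finite integer intervals $I\subseteq\mathbb N$. For a ball $V_\varepsilon(x)$ let $N(x,V_\varepsilon(x))=\{n\ge1:T^nx\in V_\varepsilon(x)\}$. $BR$ is the set of $x$ such that $N(x,V_\varepsilon(x))$ has positive Banach upper density for every $\varepsilon>0$; $QW$ is the set of $x$ such that it has positive upper density for every $\varepsilon>0$. Let $C_x=\overline{\bigcup_{m\in M_x}S_m}$, and $BR^\#=BR\setminus QW$,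 $W^\#=\{x\in BR^\#:S_\mu=C_x\ \forall\mu\in M_x\}$, $V^\#=\{x\in BR^\#:\exists\mu\in M_x,\ S_\mu=C_x\}$, $S^\#=\{x\in X:\bigcap_{\mu\in M_x}S_\mu\ne\emptyset\}$; $BR_1=W^\#$, $BR_2=V^\#\cap S^\#$, $BR_3=V^\#$, $BR_4=V^\#\cup(BR^\#\cap S^\#)$, $BR_5=BR^\#$. $QR=\{x\in X: M_x\text{ is a singleton}\}$ (quasiregular points). *)

(* Defs.v *)
From HB Require Import structures.
From mathcomp Require Import all_boot all_order all_algebra.
From mathcomp Require Import all_classical all_reals all_analysis.
Set Implicit Arguments.
Unset Strict Implicit.
Unset Printing Implicit Defensive.
Import Order.TTheory GRing.Theory Num.Theory.
Import numFieldNormedType.Exports.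
Local Open Scope classical_set_scope.
Local Open Scope ring_scope.

(* Nonempty metric spaces: the point is only there because the library's
   generated sigma-algebras live on pointed types. *)
#[short(type="pmetricType")]
HB.structure Definition PointedMetric (K : numDomainType) :=
  {M of Metric K M & Pointed M}.

Notation borel X := (g_sigma_algebraType (@open X)).

(* A library measure is a function on all subsets and its values outside of the
   sigma-algebra are arbitrary. Normalizing them to 0 makes Leibniz equality
   the equality of Borel measures (lemma borel_prob_ext), so that singletons of
   measures and equality of sets of measures have their usual meaning. *)
Record borel_prob (R : realType) (X : pmetricType R) := BorelProb {
  borel_prob_val :> probability (borel X) R ;
  borel_prob_out : forall A : set (borel X),
    ~ measurable A -> borel_prob_val A = 0%E }.

HB.instance Definition _ (R : realType) (X : pmetricType R) :=
  gen_eqMixin (borel_prob X).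
HB.instance Definition _ (R : realType) (X : pmetricType R) :=
  gen_choiceMixin (borel_prob X).

Lemma borel_prob_ext (R : realType) (X : pmetricType R) (mu nu : borel_prob X) :
  (forall A : set (borel X), measurable A -> mu A = nu A) -> mu = nu.
Proof.
case: mu nu => [mu mu0] [nu nu0] /= munu.
have {munu} E : (mu : set _ -> _) = nu.
  apply/funext => A; have [mA|mA] := pselect (measurable A); first exact: munu.
  by rewrite mu0// nu0.
have {}E : mu = nu.
  case: mu nu {mu0 nu0} E => [mu [[a1 b1] [c1] [d1] [e1] [f1] [g1] [h1]]].
  case=> [nu [[a2 b2] [c2] [d2] [e2] [f2] [g2] [h2]]] /= E; subst nu.
  rewrite (Prop_irrelevance a1 a2) (Prop_irrelevance b1 b2).
  rewrite (Prop_irrelevance c1 c2) (Prop_irrelevance d1 d2).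
  rewrite (Prop_irrelevance e1 e2) (Prop_irrelevance f1 f2).
  by rewrite (Prop_irrelevance g1 g2) (Prop_irrelevance h1 h2).
by subst nu; rewrite (Prop_irrelevance mu0 nu0).
Qed.

Section borel_restriction.
Context (R : realType) (X : pmetricType R) (mu : probability (borel X) R).
Local Open Scope ereal_scope.

Definition zero_out (A : set (borel X)) : \bar R :=
  if `[< measurable A >] then mu A else 0.

Let zero_out0 : zero_out set0 = 0.
Proof. by rewrite /zero_out measure0 if_same. Qed.

Let zero_out_ge0 A : 0 <= zero_out A.
Proof. by rewrite /zero_out; case: ifP. Qed.

Let zero_out_sigma_additive : semi_sigma_additive zero_out.
Proof.
move=> F mF tF mUF; rewrite /zero_out (asboolT mUF).
under eq_fun do under eq_bigr do rewrite (asboolT (mF _)).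
exact: measure_semi_sigma_additive.
Qed.

HB.instance Definition _ := isMeasure.Build _ _ _ zero_out
  zero_out0 zero_out_ge0 zero_out_sigma_additive.

Let zero_out_setT : zero_out setT = 1.
Proof. by rewrite /zero_out asboolT ?probability_setT//; exact: measurableT. Qed.

HB.instance Definition _ :=
  Measure_isProbability.Build _ _ _ zero_out zero_out_setT.

Let zero_out_out (A : set (borel X)) : ~ measurable A -> zero_out A = 0.
Proof. by move=> nA; rewrite /zero_out asboolF. Qed.

Definition to_borel_prob : borel_prob X := BorelProb zero_out_out.

End borel_restriction.

(* The weak-star topology: the coarsest one for which mu |-> \int f dmu is
   continuous for each real-valued continuous f. *)
Definition integrals (R : realType) (X : pmetricType R) (mu : borel_prob X) :
    {ptws continuousType X R -> R} :=
  fun f => (\int[mu]_x (f : borel X -> R) x)%R.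

HB.instance Definition _ (R : realType) (X : pmetricType R) :=
  Topological.copy (borel_prob X) (initial_topology (@integrals R X)).

Section empirical.
Context (R : realType) (X : pmetricType R) (T : X -> X) (n : nat) (x : X).

Definition empirical_fun : set (borel X) -> \bar R :=
  mscale ((n.+1%:R : R)^-1)%:nng
    (msum (fun j => dirac (iter j T x : borel X)) n.+1).

HB.instance Definition _ := Measure.on empirical_fun.

Let empirical_setT : empirical_fun setT = 1%E.
Proof.
rewrite /empirical_fun /mscale /= /msum.
rewrite (eq_bigr (fun=> 1%:E)) => [|j _]; last first.
  by rewrite /= /dirac indicT.
rewrite sumEFin sumr_const card_ord -EFinM.
by rewrite mulVf// pnatr_eq0.
Qed.

HB.instance Definition _ :=
  Measure_isProbability.Build _ _ _ empirical_fun empirical_setT.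

(* The average of the Dirac measures at the first n.+1 points of the orbit. *)
Definition empirical : borel_prob X := to_borel_prob empirical_fun.

End empirical.

Section dynamics.
Context (R : realType) (X : pmetricType R) (T : X -> X).
Implicit Types (x y : X) (E Y : set X) (mu : borel_prob X).

Definition inv_measures : set (borel_prob X) :=
  [set mu | forall A : set (borel X), measurable A -> mu (T @^-1` A) = mu A].

Definition measure_support mu : set X :=
  [set x | forall U : set X, open_nbhs x U -> (0 < mu U)%E].

Definition uniquely_ergodic := exists mu, inv_measures = [set mu].

Definition omega_limit x : set X := cluster (iter n T x @[n --> \oo]).

Definition Tran : set X := [set x | omega_limit x = setT].

Definition limit_measures x : set (borel_prob X) :=
  cluster (empirical T n x @[n --> \oo]).

(* Metric entropy. A finite Borel partition is given by its labelling
   p : X -> 'I_k; the cylinders of length n are the elements of the join of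
   the partitions T^{-j} p, j < n. *)
Definition log2 (r : R) : R := ln r / ln 2.

Definition cylinder k (p : X -> 'I_k) n (w : {ffun 'I_n -> 'I_k}) : set X :=
  [set x | forall j : 'I_n, p (iter j T x) = w j].

Definition join_entropy mu k (p : X -> 'I_k) (n : nat) : R :=
  - \sum_(w : {ffun 'I_n -> 'I_k})
      fine (mu (cylinder p w)) * log2 (fine (mu (cylinder p w))).

Definition partition_entropy mu k (p : X -> 'I_k) : \bar R :=
  limn (fun n => (join_entropy mu p n / n%:R)%:E).

Definition metric_entropy mu : \bar R :=
  ereal_sup [set h | exists k (p : X -> 'I_k),
    (forall i, measurable (p @^-1` [set i] : set (borel X))) /\
    h = partition_entropy mu p].

(* Bowen's topological entropy of a subset. A cover by balls B_m(x, e) is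
   given by the set of the pairs (x, m) used. *)
Definition bowen_ball n x (e : R) : set X :=
  [set y | forall j, (j < n)%N -> mdist (iter j T x) (iter j T y) <= e].

Definition bowen_cover E n (e : R) (C : set (X * nat)) :=
  [/\ countable C, forall p, C p -> (n <= p.2)%N &
      E `<=` \bigcup_(p in C) bowen_ball p.2 p.1 e].

Definition bowen_sum E (t : R) n (e : R) : \bar R :=
  ereal_inf [set \esum_(p in C) (2 `^ (- (t * p.2%:R)))%:E
            | C in bowen_cover E n e].

Definition bowen_outer E (t e : R) : \bar R := limn (fun n => bowen_sum E t n e).

Definition htop_scale E (e : R) : \bar R :=
  ereal_inf [set t%:E | t in [set t : R | 0 <= t /\ bowen_outer E t e = 0%E]].

Definition htop E : \bar R := lim (htop_scale E e @[e --> 0^'+]).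

Definition convex_hull_fin m (nu : 'I_m -> borel_prob X) : set (borel_prob X) :=
  [set mu | exists a : 'I_m -> R,
    [/\ forall i, 0 <= a i, \sum_i a i = 1 &
        forall A : set (borel X), measurable A ->
          mu A = (\sum_i (a i)%:E * nu i A)%E]].

Definition saturated_set (K : set (borel_prob X)) : set X :=
  [set x | Tran x /\ limit_measures x = K].

Definition transitively_convex_saturated :=
  forall K : set (borel_prob X),
    K !=set0 -> compact K -> connected K -> K `<=` inv_measures ->
    (exists m (nu : 'I_m -> borel_prob X),
       (forall i, inv_measures (nu i)) /\ K `<=` convex_hull_fin nu) ->
    saturated_set K !=set0 /\
    htop (saturated_set K) = ereal_inf [set metric_entropy mu | mu in K].

Definition entropy_dense :=
  forall mu, inv_measures mu ->
  forall G : set (borel_prob X), nbhs mu G ->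
  forall eta : R, 0 < eta ->
  exists Lambda : set X,
    [/\ closed Lambda, T @` Lambda `<=` Lambda,
        forall nu, inv_measures nu -> measure_support nu `<=` Lambda -> G nu &
        (metric_entropy mu - eta%:E < htop Lambda)%E].

Definition full_entropy_gaps (Z : seq (set X)) Y :=
  (2 <= size Z)%N /\
  forall i, (i.+1 < size Z)%N ->
    htop ((nth set0 Z i.+1 `\` nth set0 Z i) `&` Y) = htop Y.

Definition count_in (S : set nat) (a l : nat) : nat :=
  (\sum_(a <= i < a + l | `[< S i >]) 1)%N.

Definition upper_density (S : set nat) : \bar R :=
  limn_esup (fun n => ((count_in S 0 n)%:R / n%:R)%:E).

(* The upper limit over the intervals [a, a + l[ as their length l tends to
   infinity, i.e., the infimum over L of the suprema over l >= L. *)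
Definition banach_upper_density (S : set nat) : \bar R :=
  ereal_inf [set ereal_sup [set ((count_in S I.1 I.2)%:R / I.2%:R)%:E
                           | I in [set I : nat * nat | (L <= I.2)%N]]
            | L in [set: nat]].

Definition visits x (V : set X) : set nat :=
  [set n | (1 <= n)%N /\ V (iter n T x)].

Definition BR : set X :=
  [set x | forall e : R, 0 < e ->
    (0 < banach_upper_density (visits x (ball x e)))%E].

Definition QW : set X :=
  [set x | forall e : R, 0 < e ->
    (0 < upper_density (visits x (ball x e)))%E].

Definition measure_center x : set X :=
  closure (\bigcup_(mu in limit_measures x) measure_support mu).

Definition BRsharp : set X := BR `\` QW.

Definition Wsharp : set X :=
  [set x | BRsharp x /\
    forall mu, limit_measures x mu -> measure_support mu = measure_center x].

Definition Vsharp : set X :=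
  [set x | BRsharp x /\
    exists2 mu, limit_measures x mu & measure_support mu = measure_center x].

Definition Ssharp : set X :=
  [set x | \bigcap_(mu in limit_measures x) measure_support mu !=set0].

Definition BR1 : set X := Wsharp.
Definition BR2 : set X := Vsharp `&` Ssharp.
Definition BR3 : set X := Vsharp.
Definition BR4 : set X := Vsharp `|` (BRsharp `&` Ssharp).
Definition BR5 : set X := BRsharp.

Definition QR : set X := [set x | exists mu, limit_measures x = [set mu]].

End dynamics.

(* Main.v *)
Require Import Defs.
From HB Require Import structures.
From mathcomp Require Import all_boot all_order all_algebra.
From mathcomp Require Import all_classical all_reals all_analysis.
From mathcomp Require Import measurable_realfun.
From mathcomp Require Import ring lra.
Import Order.TTheory GRing.Theory Num.Theory.
Import numFieldNormedType.Exports.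
Local Open Scope classical_set_scope.
Local Open Scope ring_scope.
Set Implicit Arguments.
Unset Strict Implicit.
Unset Printing Implicit Defensive.

(* The proof produces, for every real t < htop (Tran T), compact connected sets K
   of mixtures of three invariant measures such that every mixture has entropy at
   least t, and applies saturation to K; each of the six gaps is a choice of a path K
   in the simplex, read off from the supports along the path.

   The three measures have pairwise disjoint supports with union different from X.
   To find them, the half h_top <= sup h_mu of the variational principle (Misiurewicz)
   gives mu with entropy above t; entropy density is applied near three mixtures of mu
   with another invariant measure, in disjoint neighbourhoods, and the variational
   principle is applied again inside the resulting invariant sets, which are disjoint
   since a common point would yield an invariant measure in two neighbourhoods.

   A transitive point x is always in BR, because the full support measure forces
   arbitrarily long orbit segments with many visits to a given ball, and it is not in
   QW as soon as the supports of its limit measures lie in a proper closed invariant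
   set. *)

(** Metric entropy, a supremum over partitions, is awkward to bound along mixtures. A lower bound is
    therefore carried by a single finite partition whose join entropies are at least [t * n] for
    every [n] ([entropy_ge]); common refinement and concavity pass it to every mixture. The levels
    [t] are real, so finite and infinite entropy are treated alike. Three measures are forced by the
    last two gaps, where no limit measure may charge all the supports that make up C_x. With two
    measures, a connected set of mixtures that charges both of them at some point either meets the
    open segment or would have to jump from one end to the other; in the triangle a path can charge
    all three vertices without ever charging them together. Since the supports are disjoint, the
    charged vertices can be read off from a support, and each class becomes a condition on vanishing
    weights. Limits of measures are built as limits of functionals, through Riesz representation;
    distance functions come first because they supply the continuous functions that test open
    sets. *)

Section distance_to_a_set.
Context (R : realType) (X : pmetricType R).
Implicit Types (C U : set X) (x y : X).

(* The value 1 makes the set nonempty when C is empty. *)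
Definition dist_to C x : R := inf ([set 1] `|` [set mdist x y | y in C]).

Let dist_to_has_inf C x : has_inf ([set 1] `|` [set mdist x y | y in C]).
Proof.
split; first by exists 1; left.
by exists 0 => _ [->|[y _ <-]]; [exact: ler01|exact: mdist_ge0].
Qed.

Lemma dist_to_ge0 C x : 0 <= dist_to C x.
Proof.
apply: lb_le_inf; first exact: (dist_to_has_inf C x).1.
by move=> _ [->|[y _ <-]]; [exact: ler01|exact: mdist_ge0].
Qed.

Lemma dist_to_le1 C x : dist_to C x <= 1.
Proof. by apply: ge_inf; [exact: (dist_to_has_inf C x).2|left]. Qed.

Lemma dist_to_le_mdist C x y : C y -> dist_to C x <= mdist x y.
Proof. by move=> Cy; apply: ge_inf; [exact: (dist_to_has_inf C x).2|right; exists y]. Qed.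

Lemma dist_to_in C x : C x -> dist_to C x = 0.
Proof.
move=> Cx; apply/eqP; rewrite eq_le dist_to_ge0 andbT.
by rewrite -[leRHS](mdistxx x) dist_to_le_mdist.
Qed.

Lemma dist_to_lip C x y : dist_to C x <= mdist x y + dist_to C y.
Proof.
rewrite -lerBlDl; apply: lb_le_inf; first exact: (dist_to_has_inf C y).1.
move=> _ [->|[z Cz <-]].
  by rewrite lerBlDl (le_trans (dist_to_le1 C x))// lerDr mdist_ge0.
by rewrite lerBlDl (le_trans (dist_to_le_mdist x Cz))// metric_triangle.
Qed.

Lemma dist_to_gt0 C x : closed C -> ~ C x -> 0 < dist_to C x.
Proof.
move=> cC Cx; have : nbhs x (~` C) by apply: open_nbhs_nbhs; split => //; exact: closed_openC.
move=> /nbhs_ballP[e /= e0 xeC].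
apply: (@lt_le_trans _ _ (Num.min 1 e)); first by rewrite lt_min ltr01.
apply: lb_le_inf; first exact: (dist_to_has_inf C x).1.
move=> _ [->|[y Cy <-]]; first by rewrite ge_min lexx.
rewrite ge_min; apply/orP; right; rewrite leNgt; apply/negP => xye.
by apply: (xeC y) => //; rewrite ballEmdist.
Qed.

Lemma continuous_dist_to C : continuous (dist_to C).
Proof.
move=> x; apply/cvgrPdist_lt => e e0.
near=> y.
have xye : mdist x y < e.
  by near: y; have := nbhsx_ballx x e e0; rewrite ballEmdist.
rewrite ltr_distl; apply/andP; split.
  by rewrite ltrBlDl (le_lt_trans (dist_to_lip C y x))// metric_sym ltrD2r.
by rewrite (le_lt_trans (dist_to_lip C x y))// addrC ltrD2l.
Unshelve. all: by end_near. Qed.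

(* The functions bump U k increase with k to the indicator of the open set U. *)
Definition bump U (k : nat) (x : X) : R := Num.min 1 (k%:R * dist_to (~` U) x).

Lemma bump_ge0 U k x : 0 <= bump U k x.
Proof. by rewrite le_min ler01 mulr_ge0// dist_to_ge0. Qed.

Lemma bump_le1 U k x : bump U k x <= 1.
Proof. by rewrite ge_min lexx. Qed.

Lemma bump_out U k x : ~ U x -> bump U k x = 0.
Proof. by move=> Ux; rewrite /bump dist_to_in// mulr0; apply/min_idPr. Qed.

Lemma bump_near1 U x : open U -> U x -> \forall k \near \oo, bump U k x = 1.
Proof.
move=> oU Ux.
have d0 : 0 < dist_to (~` U) x.
  by apply: dist_to_gt0; [exact: open_closedC|rewrite /setC/=; apply].
near=> k; apply/min_idPl; rewrite -ler_pdivrMr// div1r ltW//.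
by near: k; exact: nbhs_infty_gtr.
Unshelve. all: by end_near. Qed.

Lemma continuous_min_fun (Y : topologicalType) (f g : Y -> R) :
  continuous f -> continuous g -> continuous (fun z => Num.min (f z) (g z)).
Proof. by move=> cf cg z; apply: continuous_min; [exact: cf|exact: cg]. Qed.

Lemma continuous_bump U k : continuous (bump U k).
Proof.
apply: continuous_min_fun => x; first exact: cvg_cst.
by apply: cvgM; [exact: cvg_cst|exact: continuous_dist_to].
Qed.


End distance_to_a_set.

(** * Borel probability measures and integrals of continuous functions *)

Section integrals.
Context (R : realType) (X : pmetricType R).
Implicit Types (f g : X -> R) (mu : borel_prob X) (U : set X).

Lemma measurable_open_borel U : open U -> measurable (U : set (borel X)).
Proof. by move=> oU; exact: sub_sigma_algebra. Qed.

Lemma measurable_closed_borel U : closed U -> measurable (U : set (borel X)).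
Proof.
move=> cU; rewrite -(setCK U); apply: measurableC; apply: measurable_open_borel.
exact: closed_openC.
Qed.

Lemma measurable_continuous f :
  continuous f -> measurable_fun [set: borel X] (f : borel X -> R).
Proof.
move=> /continuousP cf; apply: (measurability _ (RGenOpens.measurableE R)).
move=> _ [_ [a [b ->] <-]]; rewrite setTI; apply: measurable_open_borel.
exact/cf/interval_open.
Qed.

(** Finite on every subset: [borel_prob_out] gives the value 0 outside of the sigma-algebra, so
    [prE] holds for all sets. *)
Definition pr mu (A : set X) : R := fine (mu (A : set (borel X))).

Lemma prE mu A : mu A = (pr mu A)%:E.
Proof.
rewrite fineK//; have [mA|/borel_prob_out ->//] := pselect (measurable (A : set (borel X))).
exact: fin_num_measure.
Qed.

(* prE for the other coercion path from borel_prob to functions. *)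
Lemma prEm mu A : (mu : {measure set (borel X) -> \bar R}) A = (pr mu A)%:E.
Proof. exact: prE. Qed.

Lemma pr_ge0 mu A : 0 <= pr mu A.
Proof. exact: fine_ge0. Qed.

Lemma pr_set0 mu : pr mu set0 = 0.
Proof. by rewrite /pr (_ : mu set0 = 0%E)//; exact: measure0. Qed.

Lemma prT mu : pr mu setT = 1.
Proof. by apply: EFin_inj; rewrite -prE probability_setT. Qed.

Lemma pr_le mu (A B : set (borel X)) :
  measurable A -> measurable B -> A `<=` B -> pr mu A <= pr mu B.
Proof. by move=> mA mB AB; rewrite -lee_fin -!prE le_measure// inE. Qed.

Lemma pr_le1 mu (A : set X) : pr mu A <= 1.
Proof.
rewrite -lee_fin -prE.
have [mA|/borel_prob_out ->//] := pselect (measurable (A : set (borel X))).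
exact: probability_le1.
Qed.

Lemma prC mu (A : set (borel X)) : measurable A -> pr mu (~` A) = 1 - pr mu A.
Proof. by move=> mA; apply: EFin_inj; rewrite EFinB -!prE probability_setC. Qed.

Lemma prU mu (A B : set (borel X)) : measurable A -> measurable B ->
  A `&` B = set0 -> pr mu (A `|` B) = pr mu A + pr mu B.
Proof.
move=> mA mB AB; apply: EFin_inj; rewrite EFinD -!prE measureU//.
Qed.

Lemma prU_le mu (A B : set (borel X)) : measurable A -> measurable B ->
  pr mu (A `|` B) <= pr mu A + pr mu B.
Proof. by move=> mA mB; rewrite -lee_fin EFinD -!prE; exact: measureU2. Qed.

Lemma pr_inj mu nu : (forall A, measurable (A : set (borel X)) -> pr mu A = pr nu A) ->
  mu = nu.
Proof. by move=> E; apply: borel_prob_ext => A mA; rewrite !prE E. Qed.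

Definition integ mu f : R := (\int[mu]_x (f : borel X -> R) x)%R.

Hypothesis compactX : compact [set: X].

Lemma continuous_bounded f : continuous f -> exists2 M, 0 < M & forall x, `|f x| <= M.
Proof.
move=> cf; have /compact_bounded[M [_ MP]] : compact (f @` setT).
  by apply: continuous_compact => //; exact: continuous_subspaceT.
exists (`|M| + 1); first by rewrite ltr_wpDl.
by move=> x; apply: (MP (`|M| + 1)); [rewrite (le_lt_trans (ler_norm M))// ltrDl|exists x].
Qed.

Lemma integrable_continuous mu f : continuous f ->
  mu.-integrable [set: borel X] (EFin \o (f : borel X -> R)).
Proof.
move=> cf; apply: measurable_bounded_integrable => //.
- by rewrite ltey_eq fin_num_measure.
- exact: measurable_continuous.
have [M M0 fM] := continuous_bounded cf.
exists M; split; first by rewrite gtr0_real.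
by move=> x Mx y _ /=; rewrite (le_trans (fM y))// ltW.
Qed.

Lemma integE mu f : continuous f -> (\int[mu]_x ((f : borel X -> R) x)%:E)%E = (integ mu f)%:E.
Proof.
move=> cf; rewrite /integ /Rintegral fineK//.
exact: integrable_fin_num (integrable_continuous mu cf).
Qed.

Lemma integ_cst mu c : integ mu (cst c) = c.
Proof.
by rewrite /integ /= Rintegral_cst// [X in fine X](@probability_setT _ _ _ mu) mulr1.
Qed.

Lemma integD mu f g : continuous f -> continuous g ->
  integ mu (f \+ g) = integ mu f + integ mu g.
Proof. by move=> cf cg; apply: RintegralD => //; exact: integrable_continuous. Qed.

Lemma integZ mu c f : continuous f -> integ mu (fun x => c * f x) = c * integ mu f.
Proof. by move=> cf; apply: RintegralZl => //; exact: integrable_continuous. Qed.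

Lemma le_integ mu f g : continuous f -> continuous g ->
  (forall x, f x <= g x) -> integ mu f <= integ mu g.
Proof.
by move=> cf cg fg; apply: le_Rintegral => //; exact: integrable_continuous.
Qed.

Lemma pr_le_integ mu (A : set (borel X)) f : measurable A -> continuous f ->
  (forall x, 0 <= f x) -> (forall x, A x -> 1 <= f x) -> pr mu A <= integ mu f.
Proof.
move=> mA cf f0 f1; rewrite -lee_fin -prE -integE// -[A]setIT -integral_indic//.
apply: ge0_le_integral => //.
- by apply/measurable_EFinP; exact: measurable_indic.
- by apply/measurable_EFinP; exact: measurable_continuous.
move=> x _; rewrite lee_fin indicE; case: (boolP (x \in A)) => [/set_mem/f1//|_].
exact: f0.
Qed.

Lemma integ_le_pr mu (A : set (borel X)) f : measurable A -> continuous f ->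
  (forall x, 0 <= f x) -> (forall x, f x <= 1) -> (forall x, ~ A x -> f x = 0) ->
  integ mu f <= pr mu A.
Proof.
move=> mA cf f0 f1 fA; rewrite -lee_fin -prE -integE// -[A in leRHS]setIT -integral_indic//.
apply: ge0_le_integral => //.
- by move=> x _; rewrite lee_fin f0.
- by apply/measurable_EFinP; exact: measurable_continuous.
- by apply/measurable_EFinP; exact: measurable_indic.
move=> x _; rewrite lee_fin indicE; case: (boolP (x \in A)) => [_|/negP xA]; first exact: f1.
by rewrite fA// => Ax; apply: xA; exact: mem_set.
Qed.


(** Dominated convergence with bound 1. The sequence [u] is left general because it serves for the
    bumps of an open set and for their compositions with [T], whose limit is the indicator of a
    preimage. *)
Lemma integ_indic_cvg mu (A : set (borel X)) (u : nat -> X -> R) :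
  measurable A -> (forall k, continuous (u k)) ->
  (forall k x, 0 <= u k x) -> (forall k x, u k x <= 1) ->
  (forall x, A x -> \forall k \near \oo, u k x = 1) ->
  (forall k x, ~ A x -> u k x = 0) ->
  integ mu (u k) @[k --> \oo] --> pr mu A.
Proof.
move=> mA cu u0 u1 uA unA.
have : (\int[mu]_x (EFin \o (u k : borel X -> R)) x)%E @[k --> \oo] -->
    (\int[mu]_x (EFin \o (\1_A : borel X -> R)) x)%E.
  have [|||||_ _ //] := @dominated_convergence _ _ _ mu [set: borel X] measurableT
    (fun k => EFin \o (u k : borel X -> R)) (EFin \o (\1_A : borel X -> R)) (cst 1%E).
  - by move=> k; apply/measurable_EFinP; apply: measurable_continuous.
  - by apply/measurable_EFinP; exact: measurable_indic.
  - apply: aeW => x _; rewrite /= indicE; apply: cvg_EFin; first by near=> k.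
    have [Ax|Ax] := pselect (A x).
      rewrite mem_set//; apply: cvg_near_cst; near=> k.
      by near: k; exact: uA.
    rewrite memNset//; apply: cvg_near_cst; near=> k; exact: unA.
  - exact: finite_measure_integrable_cst.
  - by apply: aeW => x k _ /=; rewrite lee_fin ger0_norm ?u0// u1.
have -> : (\int[mu]_x (EFin \o (\1_A : borel X -> R)) x = (pr mu A)%:E)%E.
  by rewrite integral_indic// setIT prEm.
by move=> /fine_cvgP[_].
Unshelve. all: by end_near. Qed.

Lemma integ_bump_cvg mu U : open U -> integ mu (bump U k) @[k --> \oo] --> pr mu U.
Proof.
move=> oU; apply: integ_indic_cvg.
- exact: measurable_open_borel.
- by move=> k; exact: continuous_bump.
- by move=> k; exact: bump_ge0.
- by move=> k; exact: bump_le1.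
- by move=> x; exact: bump_near1.
- by move=> k x; exact: bump_out.
Qed.

Lemma integ_bump_gt mu U c : open U -> c < pr mu U ->
  exists k, c < integ mu (bump U k).
Proof.
move=> oU cU; have := cvgr_gt _ (integ_bump_cvg (mu := mu) oU) _ cU.
move=> [k _ /(_ k (leqnn _))].
by exists k.
Qed.

Lemma borel_prob_open_inj mu nu : (forall U, open U -> pr mu U = pr nu U) -> mu = nu.
Proof.
move=> E; apply: borel_prob_ext => A mA.
apply: (@measure_unique _ R (borel X) (@open X) (fun=> setT) _ _ _ _ mu nu _ _ A mA) => //.
- exact: openI.
- by move=> _; exact: openT.
- by apply/seteqP; split => // x _; exists 0%N.
- by move=> B oB; rewrite !prEm E.
- by move=> _; rewrite prEm ltry.
Qed.

Lemma integ_inj mu nu : (forall f, continuous f -> integ mu f = integ nu f) -> mu = nu.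
Proof.
move=> E.
have le (m n : borel_prob X) : (forall f, continuous f -> integ m f = integ n f) ->
    forall U, open U -> pr m U <= pr n U.
  move=> mn U oU; rewrite leNgt; apply/negP => /(integ_bump_gt oU)[k].
  rewrite mn ?ltNge; last exact: continuous_bump.
  move/negP; apply; apply: integ_le_pr; first exact: measurable_open_borel.
  - exact: continuous_bump.
  - exact: bump_ge0.
  - exact: bump_le1.
  - by move=> x; exact: bump_out.
apply: borel_prob_open_inj => U oU; apply/eqP; rewrite eq_le !le//.
by move=> f cf; rewrite E.
Qed.

Lemma continuous_integ f : continuous f -> continuous (integ ^~ f).
Proof.
move=> cf mu.
have c1 := @initial_continuous _ _ (@integrals R X) mu.
have c2 := @proj_continuous _ (fun=> R) (mkcts cf : continuousType X R) (@integrals R X mu).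
exact: (continuous_comp c1 c2).
Qed.

(** The topology is initial for a map into a product, so a neighbourhood reduces to finitely many
    coordinates. An arbitrary filter is allowed because both ultrafilters and paths of measures
    occur. *)
Lemma borel_prob_cvgP (F : set_system (borel_prob X)) mu : Filter F ->
  (forall f, continuous f -> integ nu f @[nu --> F] --> integ mu f) -> F --> mu.
Proof.
move=> FF Ff.
have H : @integrals R X @ F --> (@integrals R X mu : {ptws continuousType X R -> R}).
  apply/cvg_sup => f U [V] [[W oW <-]] Wf WU; apply: filterS WU _.
  apply: (Ff f); [exact: cts_fun|exact: open_nbhs_nbhs].
move=> A [B /= [[C oC <-] Cmu] CA].
apply: filterS CA _; apply: H; exact: open_nbhs_nbhs.
Qed.

(** Some bump below the indicator of [U] already has integral above [c], and the integral of a fixed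
    continuous function depends continuously on the measure. *)
Lemma pr_lsc mu U c : open U -> c < pr mu U -> \forall nu \near mu, c < pr nu U.
Proof.
move=> oU /(integ_bump_gt oU)[k ck].
near=> nu; apply: (@lt_le_trans _ _ (integ nu (bump U k))).
  near: nu; apply: cvgr_gt ck; exact/continuous_integ/continuous_bump.
apply: integ_le_pr; first exact: measurable_open_borel.
- exact: continuous_bump.
- exact: bump_ge0.
- exact: bump_le1.
- by move=> x; exact: bump_out.
Unshelve. all: by end_near. Qed.

End integrals.

(** * Riesz representation on a compact metric space *)

Section riesz.
Context (R : realType) (X : pmetricType R) (L : (X -> R) -> R).
Implicit Types (f g : X -> R) (U V A : set X).
Hypothesis compactX : compact [set: X].
Hypothesis LD : forall f g, continuous f -> continuous g -> L (f \+ g) = L f + L g.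
Hypothesis LZ : forall c f, continuous f -> L (fun x => c * f x) = c * L f.
Hypothesis L_le : forall f g, continuous f -> continuous g ->
  (forall x, f x <= g x) -> L f <= L g.
Hypothesis L_cst : forall c, L (cst c) = c.

Definition subordinate U f :=
  [/\ continuous f, forall x, 0 <= f x, forall x, f x <= 1 & forall x, ~ U x -> f x = 0].

(** The content of the Riesz construction, meant for open sets; [riesz_outer_real] extends it to all
    sets by approximation from outside. *)
Definition inner_content U : R := sup (L @` subordinate U).

Definition riesz_outer_real A : R := inf (inner_content @` [set U | open U /\ A `<=` U]).

Definition riesz_outer A : \bar R := (riesz_outer_real A)%:E.

Let continuousD f g : continuous f -> continuous g -> continuous (f \+ g).
Proof. by move=> cf cg x; apply: cvgD; [exact: cf|exact: cg]. Qed.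

Let continuous_cst (c : R) : continuous (cst c : X -> R).
Proof. by move=> x; exact: cvg_cst. Qed.

Let continuousZ (c : R) f : continuous f -> continuous (fun x => c * f x).
Proof. by move=> cf x; apply: cvgM; [exact: cvg_cst|exact: cf]. Qed.

Let continuous_max f (a : R) : continuous f -> continuous (fun x => Num.max (f x) a).
Proof. by move=> cf x; apply: continuous_max; [exact: cf|exact: cvg_cst]. Qed.

Let L_le1 U f : subordinate U f -> L f <= 1.
Proof. by move=> [cf _ f1 _]; rewrite -(L_cst 1) L_le. Qed.

Let content_has_sup U : has_sup (L @` subordinate U).
Proof.
split; last by exists 1 => _ [f Uf <-]; exact: L_le1 Uf.
exists (L (cst 0)), (cst 0) => //; split => //; exact: continuous_cst.
Qed.

Lemma le_inner_content U f : subordinate U f -> L f <= inner_content U.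
Proof. by move=> Uf; apply: ub_le_sup; [exact: (content_has_sup U).2|exists f]. Qed.

Lemma inner_content_ge0 U : 0 <= inner_content U.
Proof.
rewrite -(L_cst 0); apply: le_inner_content; split => //; exact: continuous_cst.
Qed.

Lemma inner_content_le1 U : inner_content U <= 1.
Proof.
apply: ge_sup; first exact: (content_has_sup U).1.
by move=> _ [f Uf <-]; exact: L_le1 Uf.
Qed.

Lemma inner_content_ex U e : 0 < e -> exists2 f, subordinate U f & inner_content U < L f + e.
Proof.
move=> e0; have [_ [f Uf <-] Lf] := sup_adherent e0 (content_has_sup U).
by exists f; rewrite // -ltrBlDr.
Qed.

Lemma subset_inner_content U V : U `<=` V -> inner_content U <= inner_content V.
Proof.
move=> UV; apply: ge_sup; first exact: (content_has_sup U).1.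
move=> _ [f [cf f0 f1 fU] <-]; apply: le_inner_content; split => // x Vx.
by apply: fU => /UV.
Qed.

Let outer_has_inf A : has_inf (inner_content @` [set U | open U /\ A `<=` U]).
Proof.
split; first by exists (inner_content setT), setT => //; split => //; exact: openT.
by exists 0 => _ [U _ <-]; exact: inner_content_ge0.
Qed.

Lemma le_riesz_outer A U : open U -> A `<=` U -> riesz_outer_real A <= inner_content U.
Proof. by move=> oU AU; apply: ge_inf; [exact: (outer_has_inf A).2|exists U]. Qed.

Lemma riesz_outer_ex A e : 0 < e ->
  exists U, [/\ open U, A `<=` U & inner_content U < riesz_outer_real A + e].
Proof.
by move=> e0; have [_ [U [oU AU] <-] LU] := inf_adherent e0 (outer_has_inf A); exists U.
Qed.

Lemma riesz_outer_open U : open U -> riesz_outer_real U = inner_content U.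
Proof.
move=> oU; apply/eqP; rewrite eq_le le_riesz_outer//=.
apply: lb_le_inf; first exact: (outer_has_inf U).1.
by move=> _ [V [oV UV] <-]; exact: subset_inner_content.
Qed.

Let riesz_outer0 : riesz_outer set0 = 0%E.
Proof.
rewrite /riesz_outer riesz_outer_open; last exact: open0.
congr EFin; apply/eqP; rewrite eq_le inner_content_ge0 andbT.
apply: ge_sup; first exact: (content_has_sup set0).1.
move=> _ [f [cf f0 f1 fU] <-]; rewrite -(L_cst 0); apply: L_le => // x.
by rewrite fU.
Qed.

Let riesz_outer_ge0 A : (0 <= riesz_outer A)%E.
Proof.
rewrite lee_fin; apply: lb_le_inf; first exact: (outer_has_inf A).1.
by move=> _ [V [oV UV] <-]; exact: inner_content_ge0.
Qed.

Let riesz_outer_homo : {homo riesz_outer : A B / A `<=` B >-> (A <= B)%E}.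
Proof.
move=> A B AB; rewrite lee_fin; apply: lb_le_inf; first exact: (outer_has_inf B).1.
move=> _ [V [oV BV] <-]; apply: le_riesz_outer => //; exact: subset_trans BV.
Qed.

(* Compactness of X replaces the usual compactness of the support of f. *)
Lemma subordinate_bigcup (U : (set X)^nat) f e :
  (forall n, open (U n)) -> subordinate (\bigcup_n U n) f -> 0 < e ->
  exists n, L f <= e + \sum_(i < n) inner_content (U i).
Proof.
move=> oU [cf f0 f1 fU] e0.
have cov : near_covering [set: X] by apply/compact_near_coveringP.
(* The integer [n] is both the number of open sets and the slope of the bumps. A point where [f] is
   at least [e] lies in some [U i], and once [n] times half its distance to the complement exceeds
   1, the bump of [U i] equals 1 nearby. *)
have : \forall n \near \oo, [set: X] `<=` (fun x => f x <= e + \sum_(i < n) bump (U i) n x).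
  apply: cov => x _.
  have [fxe|efx] := ltP (f x) e.
    near=> y n => /=; rewrite ler_wpDr//.
      by apply: sumr_ge0 => i _; exact: bump_ge0.
    rewrite ltW//; near: y.
    by apply: (cvgr_lt (f x)) => //; exact: cf.
  have [i _ Uix] : (\bigcup_n U n) x.
    by apply: contrapT => /fU fx0; move: efx; rewrite fx0 leNgt e0.
  have d0 : 0 < dist_to (~` U i) x.
    by apply: dist_to_gt0; [exact: open_closedC|rewrite /setC/=; apply].
  near=> y n => /=.
  have yd : dist_to (~` U i) x / 2 < dist_to (~` U i) y.
    near: y; apply: (cvgr_gt (dist_to (~` U i) x)); first exact: continuous_dist_to.
    lra.
  have ni : (i < n)%N by near: n; exact: nbhs_infty_gt.
  rewrite ler_wpDl ?(ltW e0)// (bigD1 (Ordinal ni))//= ler_wpDr//.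
    by apply: sumr_ge0 => j _; exact: bump_ge0.
  rewrite (le_trans (f1 y))// le_min lexx/=.
  apply: (@le_trans _ _ (n%:R * (dist_to (~` U i) x / 2))); last by rewrite ler_wpM2l// ltW.
  rewrite -ler_pdivrMr ?divr_gt0// ltW//.
  by near: n; exact: nbhs_infty_gtr.
move=> [n _ /(_ n (leqnn n)) fn]; exists n.
have csum (s : seq 'I_n) : continuous (fun x => \sum_(i <- s) bump (U i) n x) /\
    L (fun x => \sum_(i <- s) bump (U i) n x) = \sum_(i <- s) L (bump (U i) n).
  elim: s => [|i s [IHc IHL]].
    rewrite big_nil; under eq_fun do rewrite big_nil.
    by split; [exact: continuous_cst|exact: L_cst].
  have E : (fun x => \sum_(j <- i :: s) bump (U j) n x) =
      bump (U i) n \+ (fun x => \sum_(j <- s) bump (U j) n x).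
    by apply/funext => x; rewrite big_cons.
  rewrite E; split; first by apply: continuousD => //; exact: continuous_bump.
  by rewrite LD ?big_cons ?IHL//; exact: continuous_bump.
apply: (@le_trans _ _ (L (cst e \+ (fun x => \sum_(i < n) bump (U i) n x)))).
  apply: L_le => //; first by apply: continuousD => //; exact: (csum _).1.
  by move=> x; exact: fn.
rewrite LD// ?L_cst; last exact: (csum _).1.
rewrite lerD2l (csum _).2; apply: ler_sum => i _; apply: le_inner_content; split.
- exact: continuous_bump.
- exact: bump_ge0.
- exact: bump_le1.
- by move=> x; exact: bump_out.
Unshelve. all: by end_near. Qed.

Let riesz_outer_sigma_subadditive : sigma_subadditive riesz_outer.
Proof.
move=> F; apply/lee_addgt0Pr => e e0.
(* The budget: [e / 2] to approximate the content of the union by [L f], one quarter for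
   [subordinate_bigcup], and one quarter spread geometrically over the sets [F n]. *)
have e2 : 0 < e / 2 by rewrite divr_gt0.
have ei n : 0 < e / 2 / 2 / (2 ^ n.+1)%:R by rewrite !divr_gt0// ltr0n expn_gt0.
pose U n := sval (cid (riesz_outer_ex (F n) (ei n))).
have UP n : [/\ open (U n), F n `<=` U n &
    inner_content (U n) < riesz_outer_real (F n) + e / 2 / 2 / (2 ^ n.+1)%:R].
  exact: (svalP (cid (riesz_outer_ex (F n) (ei n)))).
have oU n : open (U n) by case: (UP n).
have [f Uf Lf] := inner_content_ex (\bigcup_n U n) e2.
have e4 : 0 < e / 2 / 2 by lra.
have [n fn] := subordinate_bigcup oU Uf e4.
apply: (@le_trans _ _ ((\sum_(i < n) inner_content (U i))%:E + (e / 2 + e / 2 / 2)%:E)%E).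
  rewrite -EFinD lee_fin; apply: (@le_trans _ _ (inner_content (\bigcup_n U n))).
    apply: le_riesz_outer; first exact: bigcup_open.
    by apply: subset_bigcup => i _; case: (UP i).
  by rewrite (le_trans (ltW Lf))// (le_trans (lerD fn (lexx _)))//; lra.
rewrite [e in leRHS](_ : _ = e / 2 / 2 + (e / 2 + e / 2 / 2)); last by field.
rewrite (EFinD (e / 2 / 2)) addeA leeD2r//.
apply: le_trans (epsilon_trick _ _ (ltW e4)) => //.
apply: le_trans (nneseries_lim_ge n _) => //; last first.
  move=> i _ _; rewrite adde_ge0// lee_fin; exact/ltW/ei.
rewrite -sumEFin big_mkord; apply: lee_sum => i _.
by rewrite -EFinD lee_fin ltW//; case: (UP i).
Qed.

HB.instance Definition _ := isOuterMeasure.Build R X riesz_outer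
  riesz_outer0 riesz_outer_ge0 riesz_outer_homo riesz_outer_sigma_subadditive.

(** Nearly optimal functions [f] for [V] inside [U] and [g] for the rest of [A] must be added
    without exceeding 1. So [g] is supported where [f] is below [e / 4], a neighbourhood of the part
    of [A] outside [U], and [f] is replaced by its excess [f'] over [e / 4], which vanishes there.
    The choices of [V], [f], [g] and [f'] cost [e / 4] each. *)
Lemma open_caratheodory U : open U -> riesz_outer.-caratheodory U.
Proof.
move=> oU; apply: le_caratheodory_measurable => A.
rewrite -EFinD lee_fin; apply/ler_addgt0Pr => e e0.
have e4 : 0 < e / 4 by lra.
have [V [oV AV LV]] := riesz_outer_ex A e4.
have [f [cf f0 f1 fU] Lf] := inner_content_ex (V `&` U) e4.
pose W := V `&` [set x | f x < e / 4].
have oW : open W.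
  apply: openI => //; apply: (@open_comp _ _ f [set y | y < e / 4]); last exact: open_lt.
  by move=> x _; exact: cf.
have [g [cg g0 g1 gW] Lg] := inner_content_ex W e4.
pose f' x := Num.max (f x - e / 4) 0.
have cf' : continuous f'.
  by apply: continuous_max; apply: continuousD => //; exact: continuous_cst.
have f'E x : f x <= f' x + e / 4 by rewrite /f' -lerBlDr le_max lexx.
have hV : subordinate V (f' \+ g).
  split => [|x|x|x Vx] /=; first exact: continuousD.
  - by rewrite addr_ge0// le_max lexx orbT.
  - have [fxe|efx] := ltP (f x) (e / 4).
      by rewrite /f' max_r ?add0r// subr_le0 ltW.
    rewrite gW ?addr0; last by move=> [_ /=]; rewrite ltNge efx.
    by rewrite /f' max_l ?subr_ge0//; move: (f1 x); lra.
  - by rewrite gW ?addr0 /f' ?fU ?max_r//; [lra|case|case].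
have := le_inner_content hV; rewrite LD// => LV'.
have Lf' : L f <= L f' + e / 4.
  rewrite -[e / 4]L_cst -LD//; apply: L_le => //; exact: continuousD.
have AU : riesz_outer_real (A `&` U) <= inner_content (V `&` U).
  by apply: le_riesz_outer; [exact: openI|exact: setSI].
have AW : riesz_outer_real (A `&` ~` U) <= inner_content W.
  apply: le_riesz_outer => // x [/AV Vx Ux]; split => //=.
  by rewrite fU// => -[].
lra.
Qed.

Lemma borel_caratheodory (A : set (borel X)) : measurable A ->
  riesz_outer.-cara.-measurable A.
Proof.
move: A; apply: smallest_sub; last by move=> U; exact: open_caratheodory.
split; first exact: (@measurable0 _ (caratheodory_type riesz_outer)).
- by move=> A mA; rewrite setTD; exact: (@measurableC _ (caratheodory_type riesz_outer)).
- by move=> F mF; exact: (@bigcupT_measurable _ (caratheodory_type riesz_outer)).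
Qed.

Definition riesz_measure (A : set (borel X)) : \bar R := riesz_outer A.

Let riesz_sigma_additive : semi_sigma_additive riesz_measure.
Proof.
move=> F mF tF mUF; apply: (@caratheodory_measure_sigma_additive R X riesz_outer F) => //.
- by move=> i; apply: borel_caratheodory; exact: mF.
- exact: borel_caratheodory.
Qed.

HB.instance Definition _ := isMeasure.Build _ _ _ riesz_measure
  riesz_outer0 riesz_outer_ge0 riesz_sigma_additive.

Let riesz_setT : riesz_measure setT = 1%E.
Proof.
rewrite /riesz_measure /riesz_outer riesz_outer_open; last exact: openT.
congr EFin; apply/eqP; rewrite eq_le inner_content_le1 /=.
rewrite -[leLHS](L_cst 1); apply: le_inner_content; split => //.
by move=> x /(_ I).
Qed.

HB.instance Definition _ :=
  Measure_isProbability.Build _ _ _ riesz_measure riesz_setT.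

Definition riesz_prob : borel_prob X := to_borel_prob riesz_measure.

Lemma riesz_probE U : open U -> pr riesz_prob U = inner_content U.
Proof.
move=> oU; apply: EFin_inj; rewrite -prE /= /zero_out asboolT.
  by rewrite -(riesz_outer_open oU).
exact: measurable_open_borel.
Qed.

(* The layers of f at the levels k / n. *)
Let le_integ_riesz f : continuous f -> (forall x, 0 <= f x) -> (forall x, f x <= 1) ->
  L f <= integ riesz_prob f.
Proof.
move=> cf f0 f1; apply/ler_addgt0Pr => e e0.
near \oo%classic => n.
have n0 : (0 < n)%N by near: n; exact: nbhs_infty_gt.
have n0R : 0 < n%:R :> R by rewrite ltr0n.
have ne : n%:R^-1 < e.
  rewrite -[e]invrK ltf_pV2 ?posrE ?invr_gt0//; near: n; exact: nbhs_infty_gtr.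
pose u k x := Num.max (Num.min (n%:R * f x - k%:R) 1) 0.
have cu k : continuous (u k).
  apply: continuous_max; apply: continuous_min_fun; last exact: continuous_cst.
  by apply: continuousD; [exact: continuousZ|exact: continuous_cst].
have u0 k x : 0 <= u k x by rewrite le_max lexx orbT.
have u1 k x : u k x <= 1 by rewrite ge_max ge_min lexx orbT ler01.
have usum m x : \sum_(k < m) u k x = Num.min (n%:R * f x) m%:R.
  elim: m => [|m IH]; first by rewrite big_ord0 min_r// mulr_ge0.
  rewrite big_ord_recr /= IH /u -natr1; set a := n%:R * f x.
  case: (leP a m%:R) => am.
    have -> : Num.max (Num.min (a - m%:R) 1) 0 = 0.
      by apply/max_idPr; rewrite ge_min subr_le0 am.
    by rewrite addr0; apply/esym/min_idPl; lra.
  case: (leP (a - m%:R) 1) => am1.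
    have -> : Num.max (a - m%:R) 0 = a - m%:R by apply/max_idPl; lra.
    by rewrite addrC subrK; apply/esym/min_idPl; lra.
  have -> : Num.max 1 0 = 1 :> R by apply/max_idPl; lra.
  by apply/esym/min_idPr; lra.
have fE x : n%:R * f x = \sum_(k < n) u k x.
  by rewrite usum min_l// ler_piMr.
have csum m : continuous (fun x => \sum_(k < m) u k x).
  elim: m => [|m IH]; first by under eq_fun do rewrite big_ord0; exact: continuous_cst.
  under eq_fun do rewrite big_ord_recr; exact: continuousD.
pose U k := [set x | k%:R < n%:R * f x].
have oU k : open (U k).
  apply: (@open_comp _ _ (fun x => n%:R * f x) [set y | k%:R < y]); last exact: open_gt.
  by move=> x _; exact: continuousZ.
have Lu k : L (u k) <= pr riesz_prob (U k).
  rewrite riesz_probE//; apply: le_inner_content; split => // x /negP.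
  rewrite -leNgt => fk; rewrite /u max_r// ge_min; apply/orP; left.
  by rewrite subr_le0.
have Iu k : pr riesz_prob (U k.+1) <= integ riesz_prob (u k).
  apply: pr_le_integ => //; first exact: measurable_open_borel.
  move=> x; rewrite /U /= -natr1 => kf; rewrite /u le_max le_min lexx andbT.
  by apply/orP; left; lra.
have Lsum m : L (fun x => \sum_(k < m) u k x) <= 1 + integ riesz_prob (fun x => \sum_(k < m) u k x).
  (* Layer [k] is bounded above under [L] by the mass of [U k], and below under the integral by that
     of [U k.+1]. Keeping the mass of [U m] on the left makes the induction telescope; the total
     loss is 1, that is [1 / n] after division by [n]. *)
  suff : L (fun x => \sum_(k < m) u k x) + pr riesz_prob (U m) <=
      1 + integ riesz_prob (fun x => \sum_(k < m) u k x).
    by apply: le_trans; rewrite lerDl pr_ge0.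
  elim: m => [|m IH].
    under [X in L X]eq_fun do rewrite big_ord0.
    under [X in integ _ X]eq_fun do rewrite big_ord0.
    rewrite (L_cst 0) add0r; apply: le_trans (pr_le1 _ _) _.
    by rewrite (integ_cst riesz_prob 0) addr0.
  under [X in L X]eq_fun do rewrite big_ord_recr /=.
  under [X in integ _ X]eq_fun do rewrite big_ord_recr /=.
  rewrite (LD (csum m) (cu m)) (integD compactX _ (csum m) (cu m)).
  have := Lu m; have := Iu m; lra.
have := Lsum n.
have -> : (fun x => \sum_(k < n) u k x) = (fun x => n%:R * f x).
  by apply/funext => x; rewrite fE.
rewrite LZ// integZ// => Ln.
have : L f <= n%:R^-1 + integ riesz_prob f.
  by rewrite -(ler_pM2l n0R) mulrDr divff ?gt_eqF.
lra.
Unshelve. all: by end_near. Qed.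

(** The layer estimate gives one inequality for functions with values in [0, 1]; applied to [1 - f]
    it gives the other. A bounded [f] is brought to that range by the affine change
    [(f + M) / (2 M)]. *)
Theorem riesz_representation f : continuous f -> integ riesz_prob f = L f.
Proof.
move=> cf.
have E g : continuous g -> (forall x, 0 <= g x) -> (forall x, g x <= 1) ->
    integ riesz_prob g = L g.
  move=> cg g0 g1; apply/eqP; rewrite eq_le le_integ_riesz// andbT.
  have cg' : continuous (fun x => 1 + (-1) * g x).
    by apply: continuousD; [exact: continuous_cst|exact: continuousZ].
  have := le_integ_riesz cg'.
  rewrite [L _](LD (@continuous_cst 1) (@continuousZ (-1) g cg)).
  rewrite [integ _ _](integD compactX _ (@continuous_cst 1) (@continuousZ (-1) g cg)).
  rewrite LZ// integZ// L_cst integ_cst => H.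
  suff : 1 + -1 * L g <= 1 + -1 * integ riesz_prob g by lra.
  by apply: H => x; move: (g0 x) (g1 x); lra.
have [M M0 fM] := continuous_bounded compactX cf.
have cg : continuous (fun x => (2 * M)^-1 * (f x + M)).
  by apply: continuousZ; apply: continuousD => //; exact: continuous_cst.
have M2 : 0 < 2 * M by rewrite mulr_gt0.
have cfM : continuous (f \+ cst M) by apply: continuousD => //; exact: continuous_cst.
have := E _ cg; rewrite [L _](LZ _ cfM) [integ _ _](integZ compactX _ _ cfM).
rewrite (LD cf (@continuous_cst M)) (integD compactX _ cf (@continuous_cst M)) L_cst integ_cst.
move=> H; suff : (2 * M)^-1 * (integ riesz_prob f + M) = (2 * M)^-1 * (L f + M).
  by move/mulfI => /(_ (invr_neq0 (lt0r_neq0 M2))) /addIr.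
apply: H => x; have := fM x; rewrite ler_norml => /andP[f1 f2].
  by apply: mulr_ge0; [rewrite invr_ge0 ltW|lra].
by rewrite mulrC ler_pdivrMr//; lra.
Qed.

End riesz.

(** * Weak-star compactness, mixtures and image measures *)

Lemma cvg_sumr (R : realType) (T I : Type) (F : set_system T) (r : seq I) (f : I -> T -> R)
    (l : I -> R) : Filter F -> (forall i, f i x @[x --> F] --> l i) ->
  \sum_(i <- r) f i x @[x --> F] --> \sum_(i <- r) l i.
Proof.
by move=> FF fl; apply: cvg_big => [|i _]; [exact: add_continuous|exact: fl].
Qed.

Section compactness.
Context (R : realType) (X : pmetricType R).
Hypothesis compactX : compact [set: X].
Implicit Types (mu nu : borel_prob X) (f g : X -> R) (U A C : set X).

Lemma continuous_cstX (c : R) : continuous (cst c : X -> R).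
Proof. by move=> x; exact: cvg_cst. Qed.

(** Along an ultrafilter the integrals of each continuous function stay in a segment, hence
    converge. The limits form a positive normalized functional, and its Riesz measure is the limit
    of the ultrafilter. *)
Theorem compact_borel_prob : compact [set: borel_prob X].
Proof.
rewrite compact_ultra => F FU _.
have cvgF f : continuous f -> exists l : R, integ mu f @[mu --> F] --> l.
  move=> cf; have [M M0 fM] := continuous_bounded compactX cf.
  have : `[- M, M]%classic `&` cluster (integ mu f @[mu --> F]) !=set0.
    apply: segment_compact; apply: (@filterE _ F) => mu.
    have cM c : continuous (cst c : X -> R) := @continuous_cstX c.
    rewrite /= in_itv/=; apply/andP; split.
      rewrite -(integ_cst mu (- M)); apply: le_integ => // x /=.
      by have := fM x; rewrite ler_norml => /andP[].
    rewrite -[leRHS](integ_cst mu); apply: le_integ => // x /=.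
    by have := fM x; rewrite ler_norml => /andP[].
  move=> [l [_ Fl]]; exists l => A /= lA.
  have [//|nA] := in_ultra_setVsetC [set mu | A (integ mu f)] FU.
  have [x [Ax]] : ~` A `&` A !=set0 by apply: Fl lA; exact: nA.
  by [].
pose L f := lim (integ mu f @[mu --> F]).
have cvgL f : continuous f -> integ mu f @[mu --> F] --> L f.
  by move=> cf; apply/cvg_ex; exact: cvgF.
have LE f l : integ mu f @[mu --> F] --> l -> L f = l.
  by move=> /cvg_lim; exact.
have LD f g : continuous f -> continuous g -> L (f \+ g) = L f + L g.
  move=> cf cg; apply: LE.
  under eq_fun do rewrite integD//.
  by apply: cvgD; exact: cvgL.
have LZ c f : continuous f -> L (fun x => c * f x) = c * L f.
  move=> cf; apply: LE.
  under eq_fun do rewrite integZ//.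
  by apply: cvgM; [exact: cvg_cst|exact: cvgL].
have Lle f g : continuous f -> continuous g -> (forall x, f x <= g x) -> L f <= L g.
  move=> cf cg fg; apply: ler_cvg_to (cvgL _ cf) (cvgL _ cg) _.
  by apply: nearW => mu; exact: le_integ.
have Lc c : L (cst c) = c.
  by apply: LE; under eq_fun do rewrite integ_cst; exact: cvg_cst.
exists (riesz_prob compactX LD Lle Lc); split => //=.
apply: borel_prob_cvgP => f cf.
by rewrite riesz_representation//; exact: cvgL.
Qed.

(** A formula for integrals follows from the corresponding formula for open sets: the Riesz measure
    of [L] agrees with [nu] there. It yields the integrals against mixtures and images. *)
Lemma integ_determined nu (L : (X -> R) -> R) :
  (forall f g, continuous f -> continuous g -> L (f \+ g) = L f + L g) ->
  (forall c f, continuous f -> L (fun x => c * f x) = c * L f) ->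
  (forall f g, continuous f -> continuous g -> (forall x, f x <= g x) -> L f <= L g) ->
  (forall c, L (cst c) = c) ->
  (forall U, open U -> L (bump U k) @[k --> \oo] --> pr nu U) ->
  forall f, continuous f -> integ nu f = L f.
Proof.
move=> LD LZ Lle Lc LU f cf.
suff -> : nu = riesz_prob compactX LD Lle Lc by exact: riesz_representation.
apply: borel_prob_open_inj => U oU; apply: (@cvg_unique _ (@Rhausdorff R)) (LU _ oU) _.
rewrite (_ : (fun k => L (bump U k)) =
  (fun k => integ (riesz_prob compactX LD Lle Lc) (bump U k))).
  exact: integ_bump_cvg.
by apply/funext => k; rewrite riesz_representation//; exact: continuous_bump.
Qed.

Lemma pr_usc mu C c : closed C -> pr mu C < c -> \forall nu \near mu, pr nu C < c.
Proof.
move=> cC muC; have mC := measurable_closed_borel cC.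
have oC : open (~` C) by exact: closed_openC.
have : 1 - c < pr mu (~` C) by rewrite prC//; lra.
move=> /(pr_lsc compactX oC); apply: filterS => nu; rewrite prC//; lra.
Qed.

Section mixture.
Context (I : finType) (w : I -> R) (mus : I -> borel_prob X).
Hypotheses (w_ge0 : forall i, 0 <= w i) (w_sum1 : \sum_i w i = 1).

Definition mix_fun (A : set (borel X)) : \bar R := (\sum_i w i * pr (mus i) A)%:E.

Let mix0 : mix_fun set0 = 0%E.
Proof.
rewrite /mix_fun big1// => i _.
by rewrite pr_set0 mulr0.
Qed.

Let mix_ge0 A : (0 <= mix_fun A)%E.
Proof. by rewrite lee_fin sumr_ge0// => i _; rewrite mulr_ge0// pr_ge0. Qed.

Let mix_sigma_additive : semi_sigma_additive mix_fun.
Proof.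
move=> F mF tF mUF.
have -> : (fun n => \sum_(0 <= i < n) mix_fun (F i))%E =
    EFin \o (fun n => \sum_i w i * \sum_(0 <= k < n) pr (mus i) (F k)).
  apply/funext => n /=; rewrite sumEFin; congr EFin.
  by rewrite exchange_big/=; apply: eq_bigr => i _; rewrite mulr_sumr.
apply: cvg_EFin; first by near=> n.
rewrite (_ : fine \o _ = (fun n => \sum_i w i * \sum_(0 <= k < n) pr (mus i) (F k)))//.
apply: cvg_sumr => i; apply: cvgM; first exact: cvg_cst.
have := @measure_semi_sigma_additive _ _ _ (mus i) F mF tF mUF.
have -> : (fun n => \sum_(0 <= k < n) mus i (F k))%E =
    EFin \o (fun n => \sum_(0 <= k < n) pr (mus i) (F k)).
  by apply/funext => n /=; rewrite -sumEFin; apply: eq_bigr => k _; exact: prE.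
by rewrite prEm => /fine_cvgP[].
Unshelve. all: by end_near. Qed.

HB.instance Definition _ := isMeasure.Build _ _ _ mix_fun mix0 mix_ge0 mix_sigma_additive.

Let mixT : mix_fun setT = 1%E.
Proof.
by rewrite /mix_fun; under eq_bigr do rewrite prT mulr1; rewrite w_sum1.
Qed.

HB.instance Definition _ := Measure_isProbability.Build _ _ _ mix_fun mixT.

Definition mix : borel_prob X := to_borel_prob mix_fun.

Lemma pr_mix (A : set (borel X)) : measurable A -> pr mix A = \sum_i w i * pr (mus i) A.
Proof.
by move=> mA; apply: EFin_inj; rewrite -prE /= /zero_out asboolT.
Qed.

Lemma integ_mix f : continuous f -> integ mix f = \sum_i w i * integ (mus i) f.
Proof.
apply: (integ_determined (L := fun f => \sum_i w i * integ (mus i) f)).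
- move=> g h cg ch; rewrite -big_split/=; apply: eq_bigr => i _.
  by rewrite integD// mulrDr.
- move=> c g cg; rewrite mulr_sumr; apply: eq_bigr => i _.
  by rewrite integZ// mulrCA.
- move=> g h cg ch gh; apply: ler_sum => i _.
  by rewrite ler_wpM2l// le_integ.
- by move=> c; under eq_bigr do rewrite integ_cst; rewrite -mulr_suml w_sum1 mul1r.
- move=> U oU; rewrite pr_mix; last exact: measurable_open_borel.
  apply: cvg_sumr => i; apply: cvgM; first exact: cvg_cst.
  exact: integ_bump_cvg.
Qed.

End mixture.

Section image_measure.
Context (T : X -> X) (mu : borel_prob X).
Hypothesis cT : continuous T.

Lemma measurable_preimage (A : set (borel X)) : measurable A ->
  measurable (T @^-1` A : set (borel X)).
Proof.
move=> mA; rewrite -[X in measurable X]setTI.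
have : measurable_fun [set: borel X] (T : borel X -> borel X).
  apply: (@measurability _ _ (borel X) (borel X) setT T (@open X)); first by [].
  move=> _ [U oU <-]; rewrite setTI; apply: measurable_open_borel.
  by move/continuousP: cT; exact.
by apply.
Qed.

Definition image_fun (A : set (borel X)) : \bar R := mu (T @^-1` A).

Let image0 : image_fun set0 = 0%E.
Proof. by rewrite /image_fun preimage_set0; exact: measure0. Qed.

Let image_ge0 A : (0 <= image_fun A)%E.
Proof. exact: measure_ge0. Qed.

Let image_sigma_additive : semi_sigma_additive image_fun.
Proof.
move=> F mF tF mUF; rewrite /image_fun preimage_bigcup.
apply: measure_semi_sigma_additive.
- by move=> i; apply: measurable_preimage.
- apply/trivIsetP => /= i j _ _ ij; rewrite -preimage_setI.
  by move/trivIsetP : tF => ->//; rewrite preimage_set0.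
- by rewrite -preimage_bigcup; exact: measurable_preimage.
Qed.

HB.instance Definition _ := isMeasure.Build _ _ _ image_fun image0 image_ge0 image_sigma_additive.

Let imageT : image_fun setT = 1%E.
Proof. by rewrite /image_fun preimage_setT; exact: probability_setT. Qed.

HB.instance Definition _ := Measure_isProbability.Build _ _ _ image_fun imageT.

Definition image_prob : borel_prob X := to_borel_prob image_fun.

Lemma pr_image (A : set (borel X)) : measurable A -> pr image_prob A = pr mu (T @^-1` A).
Proof.
by move=> mA; apply: EFin_inj; rewrite -!prE /= /zero_out asboolT.
Qed.

Lemma integ_image f : continuous f -> integ image_prob f = integ mu (f \o T).
Proof.
have cc g : continuous g -> continuous (g \o T).
  by move=> cg x; apply: continuous_comp; [exact: cT|exact: cg].
apply: (integ_determined (L := fun f => integ mu (f \o T))).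
- by move=> g h cg ch; rewrite -integD//; exact: cc.
- by move=> c g cg; rewrite -integZ//; exact: cc.
- by move=> g h cg ch gh; apply: le_integ => //; [exact: cc|exact: cc|move=> x; exact: gh].
- by move=> c; rewrite -[RHS](integ_cst mu).
move=> U oU; rewrite pr_image; last exact: measurable_open_borel.
apply: integ_indic_cvg => //.
- by apply: measurable_preimage; exact: measurable_open_borel.
- by move=> k; apply: cc; exact: continuous_bump.
- by move=> k x; exact: bump_ge0.
- by move=> k x; exact: bump_le1.
- by move=> x Ux; exact: bump_near1.
- by move=> k x Ux; exact: bump_out.
Qed.

End image_measure.

End compactness.

(** * Invariant measures and supports *)

Section invariant_measures.
Context (R : realType) (X : pmetricType R) (T : X -> X).
Hypotheses (compactX : compact [set: X]) (cT : continuous T).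
Implicit Types (mu nu : borel_prob X) (f g : X -> R) (U A C : set X).

Lemma continuous_iter n : continuous (iter n T).
Proof.
elim: n => [|n IH] x; first exact: cvg_id.
by apply: continuous_comp; [exact: IH|exact: cT].
Qed.

Lemma measurable_iter n (A : set (borel X)) : measurable A ->
  measurable (iter n T @^-1` A : set (borel X)).
Proof. by move=> mA; apply: measurable_preimage => //; exact: continuous_iter. Qed.

Lemma inv_measures_pr mu n (A : set (borel X)) : inv_measures T mu -> measurable A ->
  pr mu (iter n T @^-1` A) = pr mu A.
Proof.
move=> imu mA; elim: n => // n IH; rewrite -IH.
have -> : iter n.+1 T @^-1` A = T @^-1` (iter n T @^-1` A).
  by apply/seteqP; split => x; rewrite /preimage /= -iterS iterSr.
by rewrite /pr (imu _ (measurable_iter n mA)).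
Qed.

Lemma inv_measures_image mu n : inv_measures T mu ->
  image_prob mu (@continuous_iter n) = mu.
Proof.
move=> imu; apply: pr_inj => A mA; rewrite pr_image//; exact: inv_measures_pr.
Qed.

Lemma inv_measures_integ mu :
  (forall f, continuous f -> integ mu (f \o T) = integ mu f) -> inv_measures T mu.
Proof.
move=> E A mA; rewrite !prE -(pr_image mu cT mA); congr (pr _ A)%:E.
by apply: integ_inj => // f cf; rewrite integ_image//; exact: E.
Qed.

Section averages.
Context (sigma : borel_prob X) (n : nat).

Let weight (j : 'I_n.+1) : R := n.+1%:R^-1.

Let weight_ge0 j : 0 <= weight j.
Proof. by rewrite invr_ge0. Qed.

Let weight_sum1 : \sum_j weight j = 1.
Proof. by rewrite /weight sumr_const card_ord -[LHS]mulr_natl divff// pnatr_eq0. Qed.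

(** The starting measure is arbitrary: a Dirac mass for Krylov-Bogoliubov, a uniform measure on a
    separated set for the variational principle. *)
Definition orbit_average : borel_prob X :=
  mix (fun j : 'I_n.+1 => image_prob sigma (@continuous_iter j)) weight_ge0 weight_sum1.

Lemma pr_orbit_average (A : set (borel X)) : measurable A ->
  pr orbit_average A = n.+1%:R^-1 * \sum_(j < n.+1) pr sigma (iter j T @^-1` A).
Proof.
move=> mA; rewrite pr_mix// mulr_sumr; apply: eq_bigr => j _.
by rewrite pr_image.
Qed.

Lemma integ_orbit_average f : continuous f ->
  integ orbit_average f = n.+1%:R^-1 * \sum_(j < n.+1) integ sigma (f \o iter j T).
Proof.
move=> cf; rewrite integ_mix// mulr_sumr; apply: eq_bigr => j _.
by rewrite integ_image.
Qed.

End averages.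

Lemma cluster_cvg (T' : topologicalType) (u : nat -> T') (v : T') (h : T' -> R) l :
  cluster (u n @[n --> \oo]) v -> {for v, continuous h} -> h (u n) @[n --> \oo] --> l ->
  h v = l.
Proof.
move=> uv ch hl; apply: Rhausdorff => A B /ch Av /hl Bl.
by have [w [Bw Aw]] := uv (h @^-1` B) _ Bl Av; exists (h w).
Qed.

(** Composing [f] with [T] shifts the orbit sum by one step, so only two boundary terms remain, at
    most [2 M / (n + 1)] after averaging. Full mass of [C] survives because the mass of a closed set
    is upper semicontinuous. *)
Lemma cluster_orbit_average (sigma : nat -> borel_prob X) C mu :
  closed C -> T @` C `<=` C -> (forall n, pr (sigma n) C = 1) ->
  cluster (orbit_average (sigma n) n @[n --> \oo]) mu ->
  inv_measures T mu /\ pr mu C = 1.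
Proof.
move=> cC TC sC clmu; split.
  apply: inv_measures_integ => f cf.
  have cfT : continuous (f \o T).
    by move=> x; apply: continuous_comp; [exact: cT|exact: cf].
  apply/subr0_eq.
  apply: (cluster_cvg (h := fun nu => integ nu (f \o T) - integ nu f) clmu).
    exact: (cvgB (F := nbhs mu) (@continuous_integ _ _ _ cfT mu) (@continuous_integ _ _ _ cf mu)).
  have [M M0 fM] := continuous_bounded compactX cf.
  apply/cvgrPdist_lt => e e0; near=> n.
  rewrite sub0r normrN !integ_orbit_average// -mulrBr -sumrB.
  have cfn j : continuous (f \o iter j T).
    by move=> x; apply: continuous_comp; [exact: continuous_iter|exact: cf].
  have -> : \sum_(i < n.+1) (integ (sigma n) (f \o T \o iter i T) -
        integ (sigma n) (f \o iter i T)) =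
      integ (sigma n) (f \o iter n.+1 T) - integ (sigma n) f.
    rewrite -(big_mkord xpredT (fun i => integ (sigma n) (f \o T \o iter i T) -
        integ (sigma n) (f \o iter i T))).
    exact: (telescope_sumr (fun i => integ (sigma n) (f \o iter i T))).
  have bnd g : continuous g -> (forall x, `|g x| <= M) -> `|integ (sigma n) g| <= M.
    move=> cg gM; rewrite ler_norml; apply/andP; split.
      rewrite -[leLHS](integ_cst (sigma n)); apply: le_integ => //; first exact: continuous_cstX.
      by move=> x /=; have := gM x; rewrite ler_norml => /andP[].
    rewrite -[leRHS](integ_cst (sigma n)); apply: le_integ => //; first exact: continuous_cstX.
    by move=> x /=; have := gM x; rewrite ler_norml => /andP[].
  rewrite normrM ger0_norm ?invr_ge0// mulrC ltr_pdivrMr//.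
  apply: le_lt_trans (ler_normB _ _) _.
  apply: (@le_lt_trans _ _ (M + M)); first apply: lerD.
  - by apply: bnd; [exact: (@cfn n.+1)|move=> x; exact: fM].
  - exact: bnd.
  rewrite mulrC -ltr_pdivrMr// (@lt_trans _ _ n%:R) ?ltr_nat//.
  near: n; exact: nbhs_infty_gtr.
apply/eqP; rewrite eq_le pr_le1 leNgt; apply/negP => /(pr_usc compactX cC) muC.
have mC := measurable_closed_borel cC.
have oC n : pr (orbit_average (sigma n) n) C = 1.
  rewrite pr_orbit_average// (eq_bigr (fun=> 1)) => [|j _].
    by rewrite sumr_const card_ord mulVf// pnatr_eq0.
  apply/eqP; rewrite eq_le pr_le1 -(sC n) pr_le//; first exact: measurable_iter.
  move=> x Cx /=; elim: (nat_of_ord j) => // i Ci.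
  by apply: TC; exists (iter i T x).
have : (orbit_average (sigma n) n @[n --> \oo]) [set nu | pr nu C = 1].
  exact: (@filterE _ \oo).
by move=> /clmu /(_ muC) [nu [/= ->]]; rewrite ltxx.
Unshelve. all: by end_near. Qed.

Lemma dirac_prob_subproof (x : X) : exists mu, forall A : set (borel X), measurable A ->
  pr mu A = (x \in A)%:R.
Proof.
exists (to_borel_prob (dirac (x : borel X))) => A mA.
by apply: EFin_inj; rewrite -prE /= /zero_out asboolT// /dirac indicE.
Qed.

Definition dirac_prob (x : X) : borel_prob X := sval (cid (dirac_prob_subproof x)).

Lemma pr_dirac x (A : set (borel X)) : measurable A -> pr (dirac_prob x) A = (x \in A)%:R.
Proof. exact: (svalP (cid (dirac_prob_subproof x))). Qed.

Lemma ex_cluster_borel_prob (u : nat -> borel_prob X) : exists mu, cluster (u n @[n --> \oo]) mu.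
Proof.
have [|mu [_ ?]] := @compact_borel_prob R X compactX (u n @[n --> \oo]) _ _.
  exact: filterT.
by exists mu.
Qed.

Lemma krylov_bogoliubov C : closed C -> T @` C `<=` C -> C !=set0 ->
  exists mu, inv_measures T mu /\ pr mu C = 1.
Proof.
move=> cC TC [x Cx].
have [mu clmu] := ex_cluster_borel_prob (fun n => orbit_average (dirac_prob x) n).
exists mu; apply: cluster_orbit_average clmu => // _.
by rewrite pr_dirac ?mem_set//; exact: measurable_closed_borel.
Qed.

End invariant_measures.

Section supports.
Context (R : realType) (X : pmetricType R).
Hypothesis compactX : compact [set: X].
Implicit Types (mu nu : borel_prob X) (U A C : set X).

Lemma measure_support_pr mu x : measure_support mu x <->
  forall U, open_nbhs x U -> 0 < pr mu U.
Proof. by split => h U /h; rewrite prE lte_fin. Qed.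

Lemma closed_measure_support mu : closed (measure_support mu).
Proof.
move=> x clx U [oU Ux].
have [y [Sy Uy]] := clx U (open_nbhs_nbhs (conj oU Ux)).
exact: Sy.
Qed.

Lemma measure_support_sub mu C : closed C -> pr mu C = 1 -> measure_support mu `<=` C.
Proof.
move=> cC C1 x /measure_support_pr Sx; apply: contrapT => Cx.
have := Sx (~` C) (conj (closed_openC cC) Cx).
by rewrite prC ?C1 ?subrr ?ltxx//; exact: measurable_closed_borel.
Qed.

(** Each point of [C] has a null open neighbourhood, and finitely many of these cover [C]. *)
Lemma pr_disjoint_support mu C : closed C -> C `&` measure_support mu = set0 -> pr mu C = 0.
Proof.
move=> cC CS.
have compactC : compact C by apply: (subclosed_compact cC compactX).
have null x : C x -> exists U, open_nbhs x U /\ pr mu U = 0.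
  move=> Cx; have : ~ measure_support mu x.
    by move=> Sx; have : (C `&` measure_support mu) x by []; rewrite CS.
  move=> /measure_support_pr/existsNP[U] /not_implyP[xU /negP]; rewrite -leNgt => U0.
  by exists U; split => //; apply/eqP; rewrite eq_le U0 pr_ge0.
pose U x : set X := if pselect (C x) is left Cx then sval (cid (null x Cx)) else set0.
have UP x : C x -> open_nbhs x (U x) /\ pr mu (U x) = 0.
  by move=> Cx; rewrite /U; case: pselect => // Cx'; exact: svalP (cid (null x Cx')).
move: compactC; rewrite compact_cover => /(_ X C U).
have oU x : C x -> open (U x) by move=> /UP[[]].
case => // [x Cx|D DC CD]; first by exists x => //; have [[]] := UP x Cx.
have null_bigU (s : seq X) : (forall i, i \in s -> C i) ->
    measurable (\big[setU/set0]_(i <- s) U i : set (borel X)) /\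
    pr mu (\big[setU/set0]_(i <- s) U i) = 0.
  elim: s => [|i s IH] sD.
    by rewrite big_nil; split => //; exact: pr_set0.
  have [|mV V0] := IH; first by move=> j js; apply: sD; rewrite inE js orbT.
  have Ci : C i by apply: sD; exact: mem_head.
  have mUi := measurable_open_borel (oU i Ci).
  rewrite big_cons; split; first exact: measurableU.
  apply/eqP; rewrite eq_le pr_ge0 andbT.
  by rewrite (le_trans (prU_le mu mUi mV))// V0 (UP i Ci).2 addr0.
have [i /DC/set_mem//|mV V0] := null_bigU (finmap.enum_fset D).
apply/eqP; rewrite eq_le pr_ge0 andbT -V0.
apply: pr_le => //; first exact: measurable_closed_borel.
by move=> x /CD[i Di Uix]; rewrite -bigcup_seq; exists i.
Qed.

Lemma measure_support_neq0 mu : measure_support mu !=set0.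
Proof.
apply/set0P/eqP => S0; have := @pr_disjoint_support mu setT closedT.
rewrite S0 setI0 prT => /(_ erefl)/eqP; by rewrite oner_eq0.
Qed.

Section support_mixture.
Context (I : finType) (w : I -> R) (mus : I -> borel_prob X).
Hypotheses (w_ge0 : forall i, 0 <= w i) (w_sum1 : \sum_i w i = 1).

Lemma measure_support_mix :
  measure_support (mix mus w_ge0 w_sum1) = \bigcup_(i in [set i | 0 < w i]) measure_support (mus i).
Proof.
apply/seteqP; split => x; last first.
  move=> [i /= wi /measure_support_pr Six]; apply/measure_support_pr => U xU.
  rewrite pr_mix; last exact: measurable_open_borel xU.1.
  rewrite (bigD1 i)//= ltr_pwDl ?mulr_gt0 ?Six// sumr_ge0// => j _.
  by rewrite mulr_ge0// pr_ge0.
move=> /measure_support_pr Sx; apply: contrapT => nSx.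
have null i : 0 < w i -> exists U, open_nbhs x U /\ pr (mus i) U = 0.
  move=> wi; have : ~ measure_support (mus i) x by move=> Six; apply: nSx; exists i.
  move=> /measure_support_pr/existsNP[U] /not_implyP[xU /negP]; rewrite -leNgt => U0.
  by exists U; split => //; apply/eqP; rewrite eq_le U0 pr_ge0.
(* An index of weight zero imposes no constraint and takes the whole space as its neighbourhood. *)
have {}null i : exists U, open_nbhs x U /\ w i * pr (mus i) U = 0.
  have [/null[U [xU U0]]|wi] := ltP 0 (w i); first by exists U; rewrite U0 mulr0.
  exists setT; split; first by split => //; exact: openT.
  by have /eqP -> : w i == 0; [rewrite eq_le wi w_ge0|rewrite mul0r].
pose U i := sval (cid (null i)).
have UP i : open_nbhs x (U i) /\ w i * pr (mus i) (U i) = 0 by exact: svalP (cid (null i)).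
have : nbhs x [set y | forall i, U i y].
  by apply: filter_forall => i; exact: open_nbhs_nbhs (UP i).1.
rewrite nbhsE => -[V xV VU]; have := Sx V xV.
have mV := measurable_open_borel xV.1.
rewrite pr_mix// big1 ?ltxx// => i _; apply/eqP; rewrite eq_le mulr_ge0 ?pr_ge0// andbT.
rewrite -(UP i).2 ler_wpM2l// pr_le//; last by move=> y /VU.
exact: measurable_open_borel (UP i).1.1.
Qed.

End support_mixture.

End supports.

(** * Entropy of finite partitions *)

Section shannon_entropy.
Context (R : realType).

(** The convention 0 log 0 = 0 is built in: the factor [a i] cancels whatever value [log2] takes at
    0. *)
Definition shannon (I : finType) (a : I -> R) : R := - \sum_i a i * log2 (a i).

Let ln2_gt0 : 0 < ln 2 :> R.
Proof. by rewrite ln_gt0// ltr1n. Qed.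

(* The tangent line inequality ln t <= t - 1 at t = m / x. *)
Lemma gibbs (x m : R) : 0 <= x -> 0 <= m -> (m = 0 -> x = 0) ->
  - (x * log2 x) <= - (x * log2 m) + (m - x) / ln 2.
Proof.
rewrite le_eqVlt => /predU1P[<-|x0] m0 mx.
  by rewrite !mul0r oppr0 add0r addr0 divr_ge0// ltW.
have {}m0 : 0 < m.
  by rewrite lt_neqAle m0 andbT; apply/eqP => /esym/mx x0'; rewrite x0' ltxx in x0.
have key : x * (ln m - ln x) <= m - x.
  rewrite -ln_div ?posrE//; have mx0 := divr_gt0 m0 x0.
  have : ln (m / x) <= m / x - 1.
    have -> : m / x = 1 + (m / x - 1) by rewrite addrC subrK.
    by rewrite (le_trans (le_ln1Dx _))//; lra.
  by rewrite -(ler_pM2l x0) mulrBr mulr1 [x * (m / x)]mulrC divfK ?gt_eqF.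
have : x * (ln m - ln x) / ln 2 <= (m - x) / ln 2 by rewrite ler_pM2r// invr_gt0.
by rewrite /log2; lra.
Qed.

(** The inequality [gibbs] compares the joint law with the product of its marginals. The correction
    terms sum to zero, both laws having total mass 1. *)
Lemma shannon_subadditive (I J : finType) (a : I * J -> R) :
  (forall k, 0 <= a k) -> \sum_k a k = 1 ->
  shannon a <= shannon (fun i => \sum_j a (i, j)) + shannon (fun j => \sum_i a (i, j)).
Proof.
move=> a0 a1; pose u i := \sum_j a (i, j); pose v j := \sum_i a (i, j).
have u0 i : 0 <= u i by exact: sumr_ge0.
have v0 j : 0 <= v j by exact: sumr_ge0.
have au i j : u i = 0 -> a (i, j) = 0.
  by move=> /eqP; rewrite psumr_eq0// => /allP/(_ j (mem_index_enum _))/eqP.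
have av i j : v j = 0 -> a (i, j) = 0.
  by move=> /eqP; rewrite psumr_eq0// => /allP/(_ i (mem_index_enum _))/eqP.
have u1 : \sum_i u i = 1 by rewrite -a1 /u pair_bigA; apply: eq_bigr => -[].
have v1 : \sum_j v j = 1 by rewrite -a1 /v exchange_big pair_bigA; apply: eq_bigr => -[].
have -> : shannon a = \sum_i \sum_j - (a (i, j) * log2 (a (i, j))).
  by rewrite /shannon -sumrN pair_bigA; apply: eq_bigr => -[].
have key i j : - (a (i, j) * log2 (a (i, j))) <=
    (- (a (i, j) * log2 (u i)) - a (i, j) * log2 (v j)) + (u i * v j - a (i, j)) / ln 2.
  have [ui0|ui0] := eqVneq (u i) 0.
    by rewrite au// !mul0r ui0 mul0r subrr mul0r oppr0 !addr0.
  have [vj0|vj0] := eqVneq (v j) 0.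
    by rewrite av// !mul0r vj0 mulr0 subrr mul0r oppr0 !addr0.
  have ui : 0 < u i by rewrite lt_neqAle eq_sym ui0 u0.
  have vj : 0 < v j by rewrite lt_neqAle eq_sym vj0 v0.
  have := @gibbs (a (i, j)) (u i * v j) (a0 _) (ltW (mulr_gt0 ui vj)).
  rewrite /log2 lnM ?posrE// mulrDl mulrDr opprD; apply.
  by move/eqP; rewrite gt_eqF ?mulr_gt0.
apply: (@le_trans _ _ (\sum_i \sum_j ((- (a (i, j) * log2 (u i)) - a (i, j) * log2 (v j)) +
    (u i * v j - a (i, j)) / ln 2))).
  by apply: ler_sum => i _; apply: ler_sum => j _; exact: key.
under eq_bigr do rewrite big_split big_split /= !sumrN -mulr_suml -!mulr_suml sumrB
  -mulr_sumr v1 mulr1 subrr mul0r addr0.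
rewrite big_split/= !sumrN exchange_big/=; apply: lerD => //.
by under [X in - X <= _]eq_bigr do rewrite -mulr_suml.
Qed.

(** The inequality [gibbs] compares each [a k i] with the barycentre [m]; the corrections cancel
    after weighting by [w]. *)
Lemma shannon_concave (I K : finType) (w : K -> R) (a : K -> I -> R) :
  (forall k, 0 <= w k) -> \sum_k w k = 1 ->
  (forall k i, 0 <= a k i) -> (forall k, \sum_i a k i = 1) ->
  \sum_k w k * shannon (a k) <= shannon (fun i => \sum_k w k * a k i).
Proof.
move=> w0 w1 a0 a1; rewrite /shannon.
under eq_bigr do rewrite mulrN mulr_sumr.
rewrite sumrN exchange_big/= -!sumrN; apply: ler_sum => i _.
set m := \sum_k w k * a k i.
have m0 : 0 <= m by apply: sumr_ge0 => k _; exact: mulr_ge0.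
have [mE|mn0] := eqVneq m 0.
  rewrite mE mul0r oppr0 -sumrN big1// => k _.
  have : w k * a k i = 0.
    move/eqP: mE; rewrite psumr_eq0 => [/allP/(_ k (mem_index_enum _))/eqP//|j _].
    exact: mulr_ge0.
  by rewrite mulrA => ->; rewrite mul0r oppr0.
have mp : 0 < m by rewrite lt_neqAle eq_sym mn0.
apply: (@le_trans _ _ (\sum_k w k * (- (a k i * log2 m) + (m - a k i) / ln 2))).
  rewrite -sumrN; apply: ler_sum => k _; rewrite -mulrN ler_wpM2l// gibbs//.
  by move=> mE; rewrite mE eqxx in mn0.
rewrite (eq_bigr (fun k => w k * a k i * - log2 m + (w k * m - w k * a k i) / ln 2)).
  by rewrite big_split/= -!mulr_suml sumrB -mulr_suml w1 mul1r subrr mul0r addr0 mulrN.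
by move=> k _; ring.
Qed.

Lemma shannon_coarsen (I J : finType) (f : I -> J) (a : I -> R) :
  (forall i, 0 <= a i) ->
  shannon (fun j => \sum_(i | f i == j) a i) <= shannon a.
Proof.
move=> a0; rewrite /shannon -!sumrN [leRHS](partition_big f xpredT)//=.
apply: ler_sum => j _; rewrite mulr_suml -sumrN; apply: ler_sum => i fij.
rewrite lerN2; have := a0 i; rewrite le_eqVlt => /predU1P[<-|ai]; first by rewrite !mul0r.
rewrite ler_pM2l// ler_pM2r ?invr_gt0//.
have le : a i <= \sum_(i | f i == j) a i.
  by rewrite (bigD1 i)//= lerDl sumr_ge0.
by rewrite ler_ln ?posrE// (lt_le_trans ai).
Qed.

Lemma shannon_ge0 (I : finType) (a : I -> R) :
  (forall i, 0 <= a i) -> (forall i, a i <= 1) -> 0 <= shannon a.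
Proof.
move=> a0 a1; rewrite /shannon -sumrN sumr_ge0// => i _.
rewrite -mulrN mulr_ge0// oppr_ge0 /log2 pmulr_lle0 ?invr_gt0//.
exact: ln_le0.
Qed.

Lemma shannon_le (I : finType) (a : I -> R) : (0 < #|I|)%N ->
  (forall i, 0 <= a i) -> \sum_i a i = 1 -> shannon a <= log2 #|I|%:R.
Proof.
move=> I0 a0 a1; have c0 : 0 < #|I|%:R :> R by rewrite ltr0n.
rewrite /shannon -sumrN.
apply: (@le_trans _ _ (\sum_i (- (a i * log2 (#|I|%:R^-1)) + (#|I|%:R^-1 - a i) / ln 2))).
  apply: ler_sum => i _; apply: gibbs => //.
  by move/eqP; rewrite invr_eq0 gt_eqF.
have S : \sum_(i : I) (#|I|%:R^-1 : R) = 1.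
  by rewrite sumr_const -[LHS]mulr_natl divff ?gt_eqF.
rewrite big_split/= sumrN -!mulr_suml sumrB a1 S.
by rewrite subrr mul0r addr0 mul1r /log2 lnV ?posrE// mulNr opprK.
Qed.

(** The value 0 is allowed because a separated set meets each label at most once but need not meet
    all of them. *)
Lemma shannon_uniform (I : finType) (a : I -> R) (N : nat) : (0 < N)%N ->
  (forall i, a i = 0 \/ a i = N%:R^-1) -> \sum_i a i = 1 -> shannon a = log2 N%:R.
Proof.
move=> N0 aN a1; have c0 : 0 < N%:R :> R by rewrite ltr0n.
rewrite /shannon (eq_bigr (fun i => a i * - log2 N%:R)).
  by rewrite -mulr_suml a1 mul1r opprK.
move=> i _; have [->|->] := aN i; first by rewrite !mul0r.
by rewrite /log2 lnV ?posrE// mulNr.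
Qed.

End shannon_entropy.

Section labellings.
Context (R : realType) (X : pmetricType R).
Implicit Types (mu : borel_prob X) (I J : finType).

Definition measurable_labelling I (p : X -> I) :=
  forall i, measurable (p @^-1` [set i] : set (borel X)).

Lemma labelling_seq mu I (p : X -> I) (s : seq I) : measurable_labelling p -> uniq s ->
  measurable ([set x | p x \in s] : set (borel X)) /\
  pr mu [set x | p x \in s] = \sum_(i <- s) pr mu (p @^-1` [set i]).
Proof.
move=> mp; elim: s => [_|i s IH /= /andP[nis us]].
  rewrite big_nil (_ : [set x | p x \in [::]] = set0); last by apply/seteqP; split.
  by split => //; exact: pr_set0.
have [ms prs] := IH us.
have -> : [set x | p x \in i :: s] = p @^-1` [set i] `|` [set x | p x \in s].
  by apply/seteqP; split => x /=; rewrite inE => /predU1P.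
split; first by apply: measurableU.
rewrite big_cons -prs prU//.
by apply/seteqP; split => // x [/= pxi]; rewrite pxi (negbTE nis).
Qed.

Lemma measurable_labelling_pred I (p : X -> I) (Q : pred I) : measurable_labelling p ->
  measurable ([set x | Q (p x)] : set (borel X)).
Proof.
(* Measurability does not involve the measure; any one extracts it from [labelling_seq]. *)
move=> mp; have [h _] := labelling_seq (dirac_prob point) mp (enum_uniq Q).
rewrite (_ : [set x | Q (p x)] = [set x | p x \in enum Q])//.
by apply/seteqP; split => x /=; rewrite mem_enum.
Qed.

Lemma pr_labelling_pred mu I (p : X -> I) (Q : pred I) : measurable_labelling p ->
  pr mu [set x | Q (p x)] = \sum_(i | Q i) pr mu (p @^-1` [set i]).
Proof.
move=> mp; have [_] := labelling_seq mu mp (enum_uniq Q); rewrite big_enum/= => <-.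
by congr pr; apply/seteqP; split => x /=; rewrite mem_enum.
Qed.

Lemma measurable_labelling_comp I J (p : X -> I) (f : I -> J) :
  measurable_labelling p -> measurable_labelling (f \o p).
Proof.
move=> mp j; rewrite (_ : _ @^-1` _ = [set x | f (p x) == j]).
  exact: (measurable_labelling_pred (fun i => f i == j) mp).
by apply/seteqP; split => x /= => [->|/eqP].
Qed.

Lemma measurable_labelling_pair I J (p : X -> I) (q : X -> J) :
  measurable_labelling p -> measurable_labelling q ->
  measurable_labelling (fun x => (p x, q x)).
Proof.
move=> mp mq [i j].
rewrite (_ : _ @^-1` _ = p @^-1` [set i] `&` q @^-1` [set j]).
  by apply: measurableI; [exact: mp|exact: mq].
by apply/seteqP; split => x /=; [case=> -> ->|case=> -> ->].
Qed.

Lemma measurable_labelling_ffun n I (p : 'I_n -> X -> I) :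
  (forall j, measurable_labelling (p j)) ->
  measurable_labelling (fun x => [ffun j => p j x]).
Proof.
move=> mp w; rewrite (_ : _ @^-1` _ = \big[setI/setT]_(j < n) (p j @^-1` [set w j])).
  by apply: bigsetI_measurable => j _; exact: mp.
rewrite -bigcap_seq; apply/seteqP; split => x /=.
  by move=> <- j _ /=; rewrite ffunE.
move=> H; apply/ffunP => j; rewrite ffunE; apply: H => /=; exact: mem_index_enum.
Qed.

Definition label_entropy mu I (p : X -> I) : R :=
  shannon (fun i => pr mu (p @^-1` [set i])).

Lemma pr_labelling_sum1 mu I (p : X -> I) : measurable_labelling p ->
  \sum_i pr mu (p @^-1` [set i]) = 1.
Proof.
move=> mp; rewrite -(@pr_labelling_pred mu I p xpredT)// -[RHS](prT mu).
by congr pr; apply/seteqP; split.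
Qed.

Lemma label_entropy_ge0 mu I (p : X -> I) : 0 <= label_entropy mu p.
Proof. by apply: shannon_ge0 => i; [exact: pr_ge0|exact: pr_le1]. Qed.

Lemma label_entropy_comp mu I J (p : X -> I) (f : I -> J) : measurable_labelling p ->
  label_entropy mu (f \o p) <= label_entropy mu p.
Proof.
move=> mp; apply: le_trans (shannon_coarsen f _); last by move=> i; exact: pr_ge0.
rewrite le_eqVlt; apply/orP; left; apply/eqP; congr shannon; apply/funext => j.
rewrite -(@pr_labelling_pred mu I p (fun i => f i == j))//; congr pr.
by apply/seteqP; split => x /= => [->|/eqP].
Qed.

Lemma label_entropy_pair mu I J (p : X -> I) (q : X -> J) :
  measurable_labelling p -> measurable_labelling q ->
  label_entropy mu (fun x => (p x, q x)) <= label_entropy mu p + label_entropy mu q.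
Proof.
move=> mp mq; have mpq := measurable_labelling_pair mp mq.
have := @shannon_subadditive R I J (fun k => pr mu ((fun x => (p x, q x)) @^-1` [set k])).
move=> /(_ (fun k => pr_ge0 mu _) (pr_labelling_sum1 mu mpq)).
rewrite /label_entropy; set a := shannon _; set b := shannon _; set c := shannon _.
suff [-> ->] : b = shannon (fun i => pr mu (p @^-1` [set i])) /\
  c = shannon (fun i => pr mu (q @^-1` [set i])) by [].
split; congr shannon; apply/funext => i.
  transitivity (\sum_(k | k.1 == i) pr mu ((fun x => (p x, q x)) @^-1` [set k])).
    rewrite (reindex_onto (fun j => (i, j)) snd) => [|[a' b'] /= /eqP->//].
    by apply: eq_bigl => j; rewrite /= !eqxx.
  rewrite -(@pr_labelling_pred mu _ (fun x => (p x, q x)) (fun k => k.1 == i))//.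
  by congr pr; apply/seteqP; split => x /= => [/eqP|->].
transitivity (\sum_(k | k.2 == i) pr mu ((fun x => (p x, q x)) @^-1` [set k])).
  rewrite (reindex_onto (fun j => (j, i)) fst) => [|[a' b'] /= /eqP->//].
  by apply: eq_bigl => j; rewrite /= !eqxx.
rewrite -(@pr_labelling_pred mu _ (fun x => (p x, q x)) (fun k => k.2 == i))//.
by congr pr; apply/seteqP; split => x /= => [/eqP|->].
Qed.

Lemma label_entropy_le mu I (p : X -> I) : measurable_labelling p ->
  label_entropy mu p <= log2 #|I|%:R.
Proof.
move=> mp; apply: shannon_le.
- by apply/card_gt0P; exists (p point).
- by move=> i; exact: pr_ge0.
- exact: pr_labelling_sum1.
Qed.

Lemma label_entropy_mix (K : finType) (w : K -> R) (mus : K -> borel_prob X)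
    (w0 : forall k, 0 <= w k) (w1 : \sum_k w k = 1) I (p : X -> I) :
  measurable_labelling p ->
  \sum_k w k * label_entropy (mus k) p <= label_entropy (mix mus w0 w1) p.
Proof.
move=> mp; rewrite /label_entropy.
rewrite [X in _ <= shannon X](_ : _ = fun i => \sum_k w k * pr (mus k) (p @^-1` [set i])).
  apply: (@shannon_concave R I K w (fun k i => pr (mus k) (p @^-1` [set i]))) => //.
  - by move=> k i; exact: pr_ge0.
  - by move=> k; exact: pr_labelling_sum1.
by apply/funext => i; rewrite pr_mix//; exact: mp.
Qed.

End labellings.

Section orbit_labels.
Context (R : realType) (X : pmetricType R) (T : X -> X).
Hypotheses (cT : continuous T).
Implicit Types (mu : borel_prob X).

Definition orbit_label k (p : X -> 'I_k) n (x : X) : {ffun 'I_n -> 'I_k} :=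
  [ffun j : 'I_n => p (iter j T x)].

Lemma join_entropyE mu k (p : X -> 'I_k) n :
  join_entropy T mu p n = label_entropy mu (orbit_label p n).
Proof.
rewrite /join_entropy /label_entropy /shannon; congr (- _); apply: eq_bigr => w _.
suff -> : cylinder T p w = orbit_label p n @^-1` [set w] by [].
apply/seteqP; split => x /=.
  by move=> xw; apply/ffunP => j; rewrite ffunE.
by move=> <- j; rewrite ffunE.
Qed.

Lemma measurable_orbit_label k (p : X -> 'I_k) n : measurable_labelling p ->
  measurable_labelling (orbit_label p n).
Proof.
move=> mp; apply: measurable_labelling_ffun => j i.
exact: (measurable_iter cT j (mp i)).
Qed.

Lemma join_entropy_ge0 mu k (p : X -> 'I_k) n : 0 <= join_entropy T mu p n.
Proof. by rewrite join_entropyE label_entropy_ge0. Qed.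

(** For a measure that need not be invariant, the last [n] labels have the law of the first [n]
    under the image by [iter m T]. The variational principle applies this to uniform measures on
    finite sets. *)
Lemma join_entropy_add mu k (p : X -> 'I_k) m n : measurable_labelling p ->
  join_entropy T mu p (m + n) <= join_entropy T mu p m +
    join_entropy T (image_prob mu (@continuous_iter R X T cT m)) p n.
Proof.
move=> mp; rewrite !join_entropyE.
pose f (u : {ffun 'I_m -> 'I_k} * {ffun 'I_n -> 'I_k}) : {ffun 'I_(m + n) -> 'I_k} :=
  [ffun j : 'I_(m + n) => match fintype.split j with inl i => u.1 i | inr i => u.2 i end].
have mq : measurable_labelling (orbit_label p n \o iter m T).
  by move=> w; exact: (measurable_iter cT m (@measurable_orbit_label k p n mp w)).
have -> : orbit_label p (m + n) =
    f \o (fun x => (orbit_label p m x, (orbit_label p n \o iter m T) x)).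
  apply/funext => x /=; apply/ffunP => j; rewrite !ffunE.
  by case: splitP => i -> /=; rewrite ffunE// addnC iterD.
apply: le_trans (label_entropy_comp _ _ _) _.
  by apply: measurable_labelling_pair => //; exact: measurable_orbit_label.
apply: le_trans (label_entropy_pair _ _ _) _ => //; first exact: measurable_orbit_label.
rewrite lerD2l le_eqVlt; apply/orP; left; apply/eqP; congr shannon; apply/funext => w.
by rewrite pr_image//; exact: measurable_orbit_label.
Qed.

Lemma join_entropy_mono mu k (p : X -> 'I_k) m n : measurable_labelling p ->
  join_entropy T mu p m <= join_entropy T mu p (m + n).
Proof.
move=> mp; rewrite !join_entropyE.
pose f (u : {ffun 'I_(m + n) -> 'I_k}) : {ffun 'I_m -> 'I_k} := [ffun j => u (lshift n j)].
have -> : orbit_label p m = f \o orbit_label p (m + n).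
  by apply/funext => x /=; apply/ffunP => j; rewrite !ffunE.
by apply: label_entropy_comp; exact: measurable_orbit_label.
Qed.

Lemma join_entropy_le mu k (p : X -> 'I_k) n : measurable_labelling p ->
  join_entropy T mu p n <= n%:R * log2 k%:R.
Proof.
move=> mp; rewrite join_entropyE; apply: le_trans (label_entropy_le _ _) _.
  exact: measurable_orbit_label.
rewrite card_ffun !card_ord natrX /log2 lnXn ?mulrA ?mulr_natl//.
by rewrite ltr0n (leq_trans _ (ltn_ord (p point))).
Qed.

Lemma join_entropy_mix (K : finType) (w : K -> R) (mus : K -> borel_prob X)
    (w0 : forall i, 0 <= w i) (w1 : \sum_i w i = 1) k (p : X -> 'I_k) n :
  measurable_labelling p ->
  \sum_i w i * join_entropy T (mus i) p n <= join_entropy T (mix mus w0 w1) p n.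
Proof.
move=> mp; rewrite join_entropyE; under eq_bigr do rewrite join_entropyE.
by apply: label_entropy_mix; exact: measurable_orbit_label.
Qed.

Lemma join_entropy_factor mu k l (p : X -> 'I_k) (f : 'I_k -> 'I_l) n :
  measurable_labelling p -> join_entropy T mu (f \o p) n <= join_entropy T mu p n.
Proof.
move=> mp; rewrite !join_entropyE.
pose g (u : {ffun 'I_n -> 'I_k}) : {ffun 'I_n -> 'I_l} := [ffun j => f (u j)].
have -> : orbit_label (f \o p) n = g \o orbit_label p n.
  by apply/funext => x /=; apply/ffunP => j; rewrite !ffunE.
by apply: label_entropy_comp; exact: measurable_orbit_label.
Qed.

(* t is a lower bound of the entropy of T, witnessed by one finite partition. *)
Definition entropy_ge mu (t : R) := exists k (p : X -> 'I_k), measurable_labelling p /\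
  forall n, t * n%:R <= join_entropy T mu p n.

Lemma common_refinement k l (p : X -> 'I_k) (q : X -> 'I_l) :
  measurable_labelling p -> measurable_labelling q ->
  exists m (r : X -> 'I_m), measurable_labelling r /\
    exists (f : 'I_m -> 'I_k) (g : 'I_m -> 'I_l), p = f \o r /\ q = g \o r.
Proof.
move=> mp mq; exists #|{: 'I_k * 'I_l}|, (enum_rank \o (fun x => (p x, q x))); split.
  by apply: measurable_labelling_comp; exact: measurable_labelling_pair.
by exists (fun i => (enum_val i).1), (fun i => (enum_val i).2); split;
  apply/funext => x /=; rewrite enum_rankK.
Qed.

Lemma common_refinement_fam (I : finType) (k : I -> nat) (p : forall i, X -> 'I_(k i)) :
  (forall i, measurable_labelling (p i)) ->
  exists m (r : X -> 'I_m), measurable_labelling r /\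
    forall i, exists f : 'I_m -> 'I_(k i), p i = f \o r.
Proof.
move=> mp.
suff H (s : seq I) : exists m (r : X -> 'I_m), measurable_labelling r /\
    forall i, i \in s -> exists f : 'I_m -> 'I_(k i), p i = f \o r.
  have [m [r [mr rP]]] := H (enum I); exists m, r; split => // i.
  by apply: rP; rewrite mem_enum.
elim: s => [|i s [m [r [mr rP]]]].
  exists 1%N, (fun=> ord0); split => // i.
  have [->|/eqP i0] := eqVneq i ord0.
    by rewrite (_ : _ @^-1` _ = setT)//; apply/seteqP; split.
  rewrite (_ : _ @^-1` _ = set0)//; apply/seteqP; split => // x /= e.
  by apply: i0.
have [m' [r' [mr' [f [g [fE gE]]]]]] := common_refinement (mp i) mr.
exists m', r'; split => // j; rewrite inE => /predU1P[->|/rP[h hE]]; first by exists f.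
by exists (h \o g); rewrite hE gE.
Qed.

(** Each measure comes with its own witnessing partition. A common refinement only increases the
    join entropies, and concavity then gives the bound for the mixture with one partition for all
    [n]. *)
Lemma entropy_ge_mix (I : finType) (w : I -> R) (mus : I -> borel_prob X)
    (w0 : forall i, 0 <= w i) (w1 : \sum_i w i = 1) t :
  (forall i, entropy_ge (mus i) t) -> entropy_ge (mix mus w0 w1) t.
Proof.
move=> H; pose k i := projT1 (cid (H i)).
pose p i : X -> 'I_(k i) := projT1 (cid (projT2 (cid (H i)))).
have pP i : measurable_labelling (p i) /\ forall n, t * n%:R <= join_entropy T (mus i) (p i) n.
  exact: (projT2 (cid (projT2 (cid (H i))))).
have [m [r [mr rP]]] := common_refinement_fam (fun i => (pP i).1).
exists m, r; split => // n; apply: le_trans (join_entropy_mix _ _ _ _ _) => //.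
have -> : t * n%:R = \sum_i w i * (t * n%:R) by rewrite -mulr_suml w1 mul1r.
apply: ler_sum => i _; apply: ler_wpM2l => //; apply: le_trans ((pP i).2 n) _.
by have [f ->] := rP i; exact: join_entropy_factor.
Qed.

End orbit_labels.

(** * Lower bounds of the metric entropy *)

Section subadditive_sequences.
Context (R : realType) (a : nat -> R).
Hypotheses (a_ge0 : forall n, 0 <= a n) (a_add : forall m n, a (m + n)%N <= a m + a n).

Let a_mul m r q : a (q * m + r)%N <= q%:R * a m + a r.
Proof.
elim: q => [|q IH]; first by rewrite mul0r add0r.
rewrite mulSn -addnA (le_trans (a_add _ _))// -natr1 mulrDl mul1r.
by rewrite addrAC [leRHS]addrC lerD2l.
Qed.

(** The infimum runs over positive lengths only, since the quotient at length 0 is 0 by the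
    convention on division. *)
Lemma fekete : a n / n%:R @[n --> \oo] -->
  inf [set a n.+1 / n.+1%:R | n in [set: nat]].
Proof.
set A := (X in inf X).
have infA : has_inf A.
  split; first by exists (a 1%N / 1%:R), 0%N.
  by exists 0 => _ [n _ <-]; exact: divr_ge0.
apply/cvgrPdist_lt => e e0.
have e2 : 0 < e / 2 by rewrite divr_gt0.
have [_ [m _ <-] am] := inf_adherent e2 infA.
pose B := \sum_(r < m.+1) a r.
have aB r : (r < m.+1)%N -> a r <= B.
  by move=> rm; rewrite /B (bigD1 (Ordinal rm))//= lerDl sumr_ge0.
near=> n.
have n0 : (0 < n)%N by near: n; exact: nbhs_infty_gt.
have n0R : 0 < n%:R :> R by rewrite ltr0n.
have Bn : B / n%:R < e / 2.
  rewrite ltr_pdivrMr// mulrC -ltr_pdivrMr//; near: n; exact: nbhs_infty_gtr.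
have lan : inf A <= a n / n%:R.
  by apply: ge_inf; [exact: infA.2|exists n.-1; rewrite // prednK].
rewrite ler0_norm ?subr_le0// opprB ltrBlDr addrC.
have key : a n <= n%:R * (a m.+1 / m.+1%:R) + B.
  rewrite {1}(divn_eq n m.+1); apply: le_trans (a_mul _ _ _) _.
  apply: lerD; last by apply: aB; rewrite ltn_mod.
  have -> : n%:R * (a m.+1 / m.+1%:R) = n%:R / m.+1%:R * a m.+1.
    by rewrite mulrA mulrAC.
  rewrite ler_wpM2r// ler_pdivlMr// -natrM ler_nat.
  exact: leq_divM.
apply: (@le_lt_trans _ _ (a m.+1 / m.+1%:R + B / n%:R)).
  by rewrite ler_pdivrMr// mulrDl divfK ?gt_eqF// mulrC.
by rewrite [e]splitr addrA ltrD.
Unshelve. all: by end_near. Qed.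

Lemma fekete_ge t : (forall n, t * n%:R <= a n) ->
  (t%:E <= limn (fun n => (a n / n%:R)%:E))%E.
Proof.
move=> ta.
have -> : limn (fun n => (a n / n%:R)%:E) =
    (inf [set a n.+1 / n.+1%:R | n in [set: nat]])%:E.
  apply/cvg_lim => //; apply: cvg_EFin; first exact: nearW.
  exact: fekete.
rewrite lee_fin; apply: lb_le_inf; first by exists (a 1%N / 1%:R), 0%N.
by move=> _ [n _ <-]; rewrite ler_pdivlMr.
Qed.

End subadditive_sequences.

Section entropy_lower_bound.
Context (R : realType) (X : pmetricType R) (T : X -> X).
Hypotheses (compactX : compact [set: X]) (cT : continuous T).
Implicit Types (mu : borel_prob X).

Lemma metric_entropy_ge mu t : inv_measures T mu -> entropy_ge T mu t ->
  (t%:E <= metric_entropy T mu)%E.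
Proof.
move=> imu [k [p [mp tp]]]; apply: (@le_trans _ _ (partition_entropy T mu p)).
  apply: fekete_ge tp; first by move=> n; exact: join_entropy_ge0.
  by move=> m n; apply: le_trans (join_entropy_add cT mu m n mp) _; rewrite inv_measures_image.
by apply: ereal_sup_ubound; exists k, p.
Qed.

Lemma continuous_mdist (x : X) : continuous (mdist x : X -> R).
Proof.
move=> y; apply/cvgrPdist_lt => e e0; near=> z.
have yz : mdist y z < e.
  by near: z; have := nbhsx_ballx y e e0; rewrite ballEmdist.
rewrite ltr_distl; apply/andP; split.
  by rewrite ltrBlDr (le_lt_trans (metric_triangle x y z))// ltrD2l.
by rewrite (le_lt_trans (metric_triangle x z y))// ltrD2l metric_sym.
Unshelve. all: by end_near. Qed.

Lemma sphere_closed (x : X) (r : R) : closed [set y | mdist x y = r].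
Proof.
have := @continuous_closedP X R (mdist x); case=> + _.
by move=> /(_ (@continuous_mdist x) [set r]); apply; exact: closed_eq.
Qed.

(* Uncountably many disjoint spheres cannot all have positive measure. *)
Lemma null_sphere mu (x : X) (e : R) : 0 < e ->
  exists2 r, e / 2 < r < e & pr mu [set y | mdist x y = r] = 0.
Proof.
move=> e0; apply: contrapT => H.
have pos r : e / 2 < r < e -> 0 < pr mu [set y | mdist x y = r].
  move=> re; rewrite lt_neqAle pr_ge0 andbT eq_sym; apply/eqP => r0; apply: H.
  by exists r.
pose A n := [set r | e / 2 < r < e /\ n.+1%:R^-1 < pr mu [set y | mdist x y = r]].
have mS r : measurable ([set y | mdist x y = r] : set (borel X)).
  by apply: measurable_closed_borel; exact: sphere_closed.
(* Any [n.+1] of these disjoint spheres would have total mass greater than 1. *)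
have finA n : finite_set (A n).
  apply: contrapT => /(infinite_set_fset n.+1)[B BA nB].
  have sumB (s : seq R) : uniq s ->
      measurable ([set y | mdist x y \in s] : set (borel X)) /\
      \sum_(r <- s) pr mu [set y | mdist x y = r] = pr mu [set y | mdist x y \in s].
    elim: s => [_|r s IH /= /andP[rs us]].
      rewrite big_nil (_ : [set y | _] = set0); last by apply/seteqP; split.
      by split => //; rewrite pr_set0.
    have [ms prs] := IH us.
    have -> : [set y | mdist x y \in r :: s] =
        [set y | mdist x y = r] `|` [set y | mdist x y \in s].
      by apply/seteqP; split => y /=; rewrite inE => /predU1P.
    split; first by apply: measurableU.
    rewrite big_cons prs prU//.
    by apply/seteqP; split => // y [/= yr]; rewrite yr (negbTE rs).
  have [_ E] := sumB (finmap.enum_fset B) (finmap.fset_uniq B).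
  have : pr mu [set y | mdist x y \in finmap.enum_fset B] <= 1 by exact: pr_le1.
  rewrite -E leNgt => /negP; apply.
  apply: (@le_lt_trans _ _ (\sum_(r <- finmap.enum_fset B) n.+1%:R^-1)).
    rewrite big_const_seq count_predT iter_addr_0 -[leRHS]mulr_natl ler_pdivlMr//.
    by rewrite mul1r ler_nat.
  rewrite big_seq [ltRHS]big_seq; apply: ltr_sum => [|r rB].
    apply/hasP; case: (finmap.enum_fset B) nB => // r s _.
    by exists r; rewrite ?mem_head.
  by have [] := BA r rB.
(* If all the spheres had positive mass, the interval of radii would be a countable union of finite
   sets, contradicting its positive Lebesgue measure. *)
have : countable [set` `]e / 2, e[].
  apply: (@sub_countable _ _ _ (\bigcup_n A n)); last first.
    by apply: bigcup_countable => // n _; exact: finite_set_countable.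
  apply: subset_card_le => r /=; rewrite in_itv/= => re.
  have p0 := pos r re.
  have [n [_ nP]] : exists n, True /\ (pr mu [set y | mdist x y = r])^-1 < n.+1%:R.
    exists (Num.truncn (pr mu [set y | mdist x y = r])^-1); split => //; exact: truncnS_gt.
  exists n => //; split => //.
  by rewrite invf_plt ?posrE.
move=> /countable_lebesgue_measure0; rewrite lebesgue_measure_itv/= lte_fin.
rewrite ifT; last lra.
by move=> /eqP; rewrite -EFinB eqe subr_eq0 => /eqP; lra.
Qed.

(* The open set O is the complement of the boundaries of the cells. *)
Lemma small_partition mu (e : R) : 0 < e ->
  exists k (p : X -> 'I_k), measurable_labelling p /\
    (forall x y, p x = p y -> mdist x y <= e) /\
    exists O, [/\ open O, pr mu O = 1 & forall i, open (O `&` p @^-1` [set i])].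
Proof.
(* Radii below [e / 2] keep two points of one ball within [e]. A label records which balls of a
   finite cover contain the point, so every cell lies inside a ball. *)
move=> e0; have e2 : 0 < e / 2 by rewrite divr_gt0.
pose r x := sval (cid2 (null_sphere mu x e2)).
have rP x : e / 2 / 2 < r x < e / 2.
  by rewrite /r; case: cid2.
have r0 x : pr mu [set y | mdist x y = r x] = 0.
  by rewrite /r; case: cid2.
have rgt0 x : 0 < r x by case/andP: (rP x) => + _; apply: lt_trans; lra.
have oball x : open [set y | mdist x y < r x].
  apply: (@open_comp _ _ (mdist x) [set z | z < r x]); last exact: open_lt.
  by move=> y _; exact: continuous_mdist.
move: compactX; rewrite compact_cover.
move=> /(_ X setT (fun x => [set y | mdist x y < r x]) (fun x _ => oball x)).
case=> [x _|D _ cov]; first by exists x => //=; rewrite mdistxx.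
pose s := finmap.enum_fset D; pose c (j : 'I_(size s)) := tnth (in_tuple s) j.
pose b x : {ffun 'I_(size s) -> bool} := [ffun j => mdist (c j) x < r (c j)].
have mb : measurable_labelling b.
  apply: measurable_labelling_ffun => j; case.
    rewrite (_ : _ @^-1` _ = [set y | mdist (c j) y < r (c j)]).
      by apply: measurable_open_borel; exact: oball.
    by apply/seteqP; split => y.
  rewrite (_ : _ @^-1` _ = ~` [set y | mdist (c j) y < r (c j)]).
    by apply: measurableC; apply: measurable_open_borel; exact: oball.
  by apply/seteqP; split => y /= => [->|/negP/negbTE].
exists #|{ffun 'I_(size s) -> bool}|, (enum_rank \o b).
split; first exact: measurable_labelling_comp.
split.
  move=> x y /enum_rank_inj bxy; have [z zD zx] := cov x I.
  have zs : z \in s by exact: zD.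
  have [j zE] : exists j : 'I_(size s), z = c j.
    by have /tnthP[j ->] : z \in in_tuple s := zs; exists j.
  have := congr1 (fun u : {ffun 'I_(size s) -> bool} => u j) bxy.
  rewrite /b !ffunE -zE; move: (zx) => /= -> /esym zy.
  rewrite (le_trans (metric_triangle x z y))// metric_sym.
  by have /andP[_ rz] := rP z; move: zx zy => /=; lra.
pose S j := [set y | mdist (c j) y = r (c j)].
have cS j : closed (S j) by exact: sphere_closed.
pose O := [set y | forall j, ~ S j y].
have nearO x : O x -> \forall y \near x, O y /\ b y = b x.
  move=> Ox; have : \forall y \near x, forall j, ~ S j y /\
      (mdist (c j) y < r (c j)) = (mdist (c j) x < r (c j)).
    apply: filter_forall => j.
    have := Ox j; rewrite /S/= => /eqP; rewrite neq_lt => /orP[xr|xr]; near=> y.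
      have yr : mdist (c j) y < r (c j).
        by near: y; apply: (cvgr_lt (mdist (c j) x)) => //; exact: continuous_mdist.
      by rewrite xr yr; split => // yE; rewrite yE ltxx in yr.
    have yr : r (c j) < mdist (c j) y.
      by near: y; apply: (cvgr_gt (mdist (c j) x)) => //; exact: continuous_mdist.
    rewrite (lt_gtF xr) (lt_gtF yr); split => // yE; by rewrite yE ltxx in yr.
  apply: filterS => y H; split; first by move=> j; case: (H j).
  by apply/ffunP => j; rewrite !ffunE; case: (H j).
exists O; split.
- by rewrite openE => x /nearO; apply: filterS => y [].
- have [mO O0] : measurable (~` O : set (borel X)) /\ pr mu (~` O) = 0.
    have -> : ~` O = [set y | exists2 j, j \in enum 'I_(size s) & S j y].
      apply/seteqP; split => y /=.
        by move=> /existsNP[j /contrapT Sj]; exists j; rewrite ?mem_enum.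
      by move=> [j _ Sj] /(_ j).
    elim: (enum _) => [|j l [IHm IH0]].
      rewrite (_ : [set y | _] = set0); last by apply/seteqP; split => // y [].
      by split => //; exact: pr_set0.
    have -> : [set y | exists2 i, i \in j :: l & S i y] =
        S j `|` [set y | exists2 i, i \in l & S i y].
      apply/seteqP; split => y /=.
        move=> [i]; rewrite inE => /predU1P[->|il Si]; first by left.
        by right; exists i.
      move=> [Sj|[i il Si]]; first by exists j; rewrite ?mem_head.
      by exists i; rewrite // inE il orbT.
    have mSj : measurable (S j : set (borel X)) by exact: measurable_closed_borel.
    split; first exact: measurableU.
    apply/eqP; rewrite eq_le pr_ge0 andbT (le_trans (prU_le mu mSj IHm))//.
    by rewrite IH0 addr0 r0.
  by rewrite -(setCK O) prC// O0 subr0.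
- move=> i; rewrite openE => x [Ox xi]; move: (nearO x Ox).
  by apply: filterS => y [Oy byx]; split => //=; rewrite byx.
Unshelve. all: by end_near. Qed.

End entropy_lower_bound.

(** * Upper semicontinuity of the entropy of a partition with null boundary *)

Section entropy_upper_semicontinuity.
Context (R : realType).

Let ln2_gt0 : 0 < ln 2 :> R.
Proof. by rewrite ln_gt0// ltr1n. Qed.

(** Near a positive [a] this is continuity. At 0 the logarithm blows up, and the tangent bound
    [gibbs] at a fixed small [m] replaces it: as [b] tends to 0 the bound tends to [m / ln 2], which
    is [e / 2]. *)
Lemma xlog2x_usc (a e : R) : 0 <= a -> 0 < e ->
  \forall b \near a, 0 <= b -> - (b * log2 b) < - (a * log2 a) + e.
Proof.
rewrite le_eqVlt => /predU1P[<-|a0] e0.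
  pose m := e * ln 2 / 2.
  have m0 : 0 < m by rewrite !mulr_gt0// invr_gt0.
  have : (- (b * log2 m) + m / ln 2) @[b --> (0 : R)] --> - (0 * log2 m) + m / ln 2.
    by apply: cvgD; [apply: cvgN; apply: cvgMl|exact: cvg_cst].
  rewrite !mul0r oppr0 !add0r => H.
  have me : m / ln 2 < e.
    by rewrite /m mulrAC mulfK ?gt_eqF//; lra.
  move/cvgr_lt : H => /(_ _ me); apply: filterS => b bm b0.
  apply: le_lt_trans bm; apply: le_trans (gibbs b0 (ltW m0) _) _.
    by move=> m0'; rewrite m0' ltxx in m0.
  by rewrite lerD2l ler_pM2r ?invr_gt0// gerBl.
have : - (b * log2 b) @[b --> a] --> - (a * log2 a).
  apply: cvgN; apply: cvgM; first exact: cvg_id.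
  by apply: cvgM; [exact: continuous_ln|exact: cvg_cst].
have ae : - (a * log2 a) < - (a * log2 a) + e by rewrite ltrDl.
by move=> /cvgr_lt /(_ _ ae); apply: filterS => b.
Qed.

Lemma shannon_usc (I : finType) (a : I -> R) (e : R) : (forall i, 0 <= a i) -> 0 < e ->
  exists2 d : R, 0 < d & forall b : I -> R,
    (forall i, 0 <= b i) -> (forall i, `|b i - a i| < d) -> shannon b < shannon a + e.
Proof.
move=> a0 e0.
pose c : R := #|I|.+1%:R.
have c0 : 0 < c by rewrite ltr0n.
have ex i : exists d : R, 0 < d /\
    forall b, 0 <= b -> `|b - a i| < d -> - (b * log2 b) < - (a i * log2 (a i)) + e / c.
  have /nbhs_ballP[d /= d0 dP] := xlog2x_usc (a0 i) (divr_gt0 e0 c0).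
  exists d; split => // b b0 bd; apply: dP => //.
  by rewrite /ball /= distrC.
pose d i := sval (cid (ex i)).
have dP i : 0 < d i /\
    forall b, 0 <= b -> `|b - a i| < d i -> - (b * log2 b) < - (a i * log2 (a i)) + e / c.
  exact: svalP (cid (ex i)).
exists (\big[Num.min/1]_i d i).
  by apply: lt_bigmin => // i _; case: (dP i).
move=> b b0 bd; rewrite /shannon -!sumrN.
apply: (@le_lt_trans _ _ (\sum_i (- (a i * log2 (a i)) + e / c))).
  apply: ler_sum => i _; apply: ltW; apply: (dP i).2 => //.
  by apply: lt_le_trans (bd i) _; exact: bigmin_le_cond.
rewrite big_split/= ltrD2l sumr_const -[ltLHS]mulr_natl mulrCA gtr_pMr//.
by rewrite ltr_pdivrMr// mul1r ltr_nat.
Qed.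

End entropy_upper_semicontinuity.

Section join_entropy_usc.
Context (R : realType) (X : pmetricType R) (T : X -> X).
Hypotheses (compactX : compact [set: X]) (cT : continuous T).
Implicit Types (mu : borel_prob X).

Lemma pr_setI_full mu (A B : set (borel X)) : measurable A -> measurable B ->
  pr mu B = 1 -> pr mu (A `&` B) = pr mu A.
Proof.
move=> mA mB B1; apply/eqP; rewrite eq_le pr_le//=; last exact: measurableI.
have mAB : measurable (A `&` B) by exact: measurableI.
have mAC : measurable (A `&` ~` B) by apply: measurableI => //; exact: measurableC.
rewrite -{1}(setIT A) -(setUv B) setIUr (le_trans (prU_le mu mAB mAC))//.
rewrite gerDl; apply: (@le_trans _ _ (pr mu (~` B))); last by rewrite prC// B1 subrr.
by apply: pr_le => //; exact: measurableC.
Qed.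

(** By invariance, almost every point has its first [q] iterates in [O], and on that set the cells
    of the join are open. Lower semicontinuity bounds their masses from below; since all masses sum
    to 1, lower bounds on the other cells give the upper bound on each one. *)
Lemma join_entropy_usc mu k (p : X -> 'I_k) q (e : R) : inv_measures T mu ->
  measurable_labelling p ->
  (exists O, [/\ open O, pr mu O = 1 & forall i, open (O `&` p @^-1` [set i])]) ->
  0 < e -> \forall nu \near mu, join_entropy T nu p q < join_entropy T mu p q + e.
Proof.
move=> imu mp [] O [] oO O1 oOp e0.
have mO := measurable_open_borel oO.
have mlab := @measurable_orbit_label R X T cT k p q mp.
pose OO n := \big[setI/setT]_(j < n) (iter j T @^-1` O).
have OOP n : measurable (OO n : set (borel X)) /\ pr mu (OO n) = 1.
  elim: n => [|n [mn n1]]; first by rewrite /OO big_ord0; split; [exact: measurableT|exact: prT].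
  have mi := measurable_iter cT n mO.
  rewrite /OO big_ord_recr/=; split; first exact: measurableI.
  by rewrite pr_setI_full// inv_measures_pr.
pose cell (w : {ffun 'I_q -> 'I_k}) := orbit_label T p q @^-1` [set w].
have ocell w : open (cell w `&` OO q).
  rewrite openE => x [/= xw xO].
  have : \forall y \near x, forall j : 'I_q, (O `&` p @^-1` [set w j]) (iter j T y).
    apply: filter_forall => j; apply: (continuous_iter cT); apply: open_nbhs_nbhs; split => //.
    split; last by rewrite -xw /= ffunE.
    by move: xO; rewrite /OO -bigcap_seq => /(_ j); apply => /=; exact: mem_index_enum.
  apply: filterS => y H; split.
    by apply/ffunP => j; rewrite ffunE; case: (H j).
  by rewrite /OO -bigcap_seq => j _; case: (H j).
have [d d0 dP] := shannon_usc (fun w => pr_ge0 mu (cell w)) e0.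
(* The tolerance [d / N] is small enough that the errors of all the other cells together stay below
   [d]. *)
pose N : R := #|{ffun 'I_q -> 'I_k}|.+1%:R.
have N0 : 0 < N by rewrite ltr0n.
have : \forall nu \near mu, forall w, pr mu (cell w) - d / N < pr nu (cell w `&` OO q).
  apply: (@filter_forall _ _ (fun w nu => pr mu (cell w) - d / N < pr nu (cell w `&` OO q))
    (nbhs mu)) => w; apply: (pr_lsc compactX (ocell w)).
  rewrite pr_setI_full//; [|exact: mlab|exact: (OOP q).1|exact: (OOP q).2].
  by rewrite ltrBlDr ltrDl divr_gt0.
apply: filterS => nu H; rewrite !join_entropyE; apply: dP; first by move=> w; exact: pr_ge0.
have lo w : pr mu (cell w) - d / N < pr nu (cell w).
  apply: lt_le_trans (H w) _; apply: pr_le; [|exact: mlab|by move=> x []].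
  by apply: measurableI; [exact: mlab|exact: (OOP q).1].
have dN : d / N < d by rewrite ltr_pdivrMr// ltr_pMr// ltr1n ltnS; apply/card_gt0P;
  exists (orbit_label T p q point).
move=> w; change (`|pr nu (cell w) - pr mu (cell w)| < d).
rewrite ltr_norml; apply/andP; split; first by rewrite ltrBrDl (lt_trans _ (lo w))// ltrD2l ltrN2.
have smu : \sum_v pr mu (cell v) = 1 := pr_labelling_sum1 mu mlab.
have snu : \sum_v pr nu (cell v) = 1 := pr_labelling_sum1 nu mlab.
rewrite (bigD1 w)//= in smu; rewrite (bigD1 w)//= in snu.
have : \sum_(v | v != w) (pr mu (cell v) - d / N) <= \sum_(v | v != w) pr nu (cell v).
  by apply: ler_sum => v _; exact: ltW (lo v).
rewrite sumrB sumr_const -[X in _ - X <= _]mulr_natl => Hs.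
have : #|[pred v | v != w]|%:R * (d / N) < d.
  rewrite mulrCA gtr_pMr// ltr_pdivrMr// mul1r ltr_nat ltnS; exact: max_card.
have fin (x y s s' u : R) : x + s = 1 -> y + s' = 1 -> s - u <= s' -> u < d -> y - x < d.
  by lra.
exact: fin smu snu Hs.
Qed.

End join_entropy_usc.

(** * The variational principle for closed invariant sets *)

Section bowen_entropy.
Context (R : realType) (X : pmetricType R) (T : X -> X).
Implicit Types (E F : set X) (t e : R).

Lemma bowen_sum_ge0 E t n e : (0 <= bowen_sum T E t n e)%E.
Proof.
apply: le_ereal_inf_tmp => _ [C _ <-]; apply: esum_ge0 => p _.
by rewrite lee_fin powR_ge0.
Qed.

Lemma le_bowen_sum E F t m n e e' : E `<=` F -> (m <= n)%N -> e <= e' ->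
  (bowen_sum T E t m e' <= bowen_sum T F t n e)%E.
Proof.
move=> EF mn ee'; apply: ereal_inf_le_tmp => _ [C [cC Cn FC] <-]; exists C => //.
split => // [p /Cn|x /EF/FC[p Cp xp]]; first exact: leq_trans.
by exists p => // j jp; apply: le_trans (xp j jp) ee'.
Qed.

Lemma bowen_outerE E t e : bowen_outer T E t e = ereal_sup (range (fun n => bowen_sum T E t n e)).
Proof.
apply/cvg_lim => //; apply: ereal_nondecreasing_cvgn => m n mn.
exact: le_bowen_sum.
Qed.

Lemma bowen_outer_ge0 E t e : (0 <= bowen_outer T E t e)%E.
Proof.
rewrite bowen_outerE; apply: le_trans (ereal_sup_ubound _); last by exists 0%N.
exact: bowen_sum_ge0.
Qed.

Lemma le_bowen_outer E F t e e' : E `<=` F -> e <= e' ->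
  (bowen_outer T E t e' <= bowen_outer T F t e)%E.
Proof.
move=> EF ee'; rewrite !bowen_outerE; apply: ge_ereal_sup => _ [n _ <-].
apply: le_trans (ereal_sup_ubound _); last by exists n.
exact: le_bowen_sum.
Qed.

Lemma htop_scale_ge0 E e : (0 <= htop_scale T E e)%E.
Proof. by apply: le_ereal_inf_tmp => _ [t [t0 _] <-]; rewrite lee_fin. Qed.

Lemma le_htop_scale E F e e' : E `<=` F -> e <= e' ->
  (htop_scale T E e' <= htop_scale T F e)%E.
Proof.
move=> EF ee'; apply: ereal_inf_le_tmp => _ [t [t0 Ft0] <-]; exists t => //; split => //.
apply/eqP; rewrite eq_le bowen_outer_ge0 andbT -Ft0; exact: le_bowen_outer.
Qed.

(** Smaller balls make covering harder, so the limit at 0 is monotone. *)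
Lemma htopE E : htop T E = ereal_sup (htop_scale T E @` [set e | 0 < e]).
Proof.
apply/cvg_lim => //.
have := @nonincreasing_at_right_cvge R (htop_scale T E) 0 +oo%O isT.
rewrite (_ : [set` Interval (BRight 0) +oo%O] = [set e | 0 < e]); last first.
  by apply/seteqP; split => x /=; rewrite in_itv/= andbT.
by apply => x y _ _ xy; exact: le_htop_scale.
Qed.

Lemma htop_ge0 E : (0 <= htop T E)%E.
Proof.
rewrite htopE; apply: le_trans (ereal_sup_ubound _); last by exists 1 => //=.
exact: htop_scale_ge0.
Qed.

Lemma le_htop E F : E `<=` F -> (htop T E <= htop T F)%E.
Proof.
move=> EF; rewrite !htopE; apply: ge_ereal_sup => _ [e e0 <-].
apply: le_trans (ereal_sup_ubound _); last by exists e.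
exact: le_htop_scale.
Qed.

Lemma htop_gt E t : 0 <= t -> (t%:E < htop T E)%E ->
  exists e c : R, [/\ 0 < e, 0 < c & \forall n \near \oo, (c%:E <= bowen_sum T E t n e)%E].
Proof.
move=> t0; rewrite htopE => /ereal_sup_gt[_ [e /= e0 <-]] te.
have : bowen_outer T E t e != 0%E.
  apply/eqP => B0; have : (htop_scale T E e <= t%:E)%E.
    by apply: ereal_inf_lbound; exists t.
  by rewrite leNgt te.
rewrite neq_lt ltNge bowen_outer_ge0/= bowen_outerE => /ereal_sup_gt[_ [m _ <-]] B0.
have [c [c0 cB]] : exists c : R, 0 < c /\ (c%:E <= bowen_sum T E t m e)%E.
  move: B0; case: (bowen_sum T E t m e) => [r|_|//].
    by rewrite lte_fin => r0; exists r.
  by exists 1; split => //; rewrite leey.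
exists e, c; split => //; near=> n; apply: le_trans cB _; apply: le_bowen_sum => //.
by near: n; exact: nbhs_infty_ge.
Unshelve. all: by end_near. Qed.

Lemma bowen_sum_le_size E t n e (s : seq X) : uniq s ->
  (forall x, E x -> exists2 y, y \in s & bowen_ball T n y e x) ->
  (bowen_sum T E t n e <= ((size s)%:R * 2 `^ (- (t * n%:R)))%:E)%E.
Proof.
move=> us cov; pose r := [seq (x, n) | x <- s].
have ur : uniq r by rewrite map_inj_uniq// => x y [].
have fr : finite_set [set` r] by exact: finite_seq.
apply: le_trans (ereal_inf_lbound _) _.
  exists [set` r] => //; split; first exact: finite_set_countable.
    by move=> p /= /mapP[x _ ->].
  move=> x /cov[y ys xy]; exists (y, n) => //=; exact: map_f.
rewrite esum_fset//.
rewrite -fsbig_seq// big_map /= sumEFin lee_fin.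
by rewrite big_const_seq count_predT iter_addr_0 mulr_natl.
Qed.

Definition separated n e (s : seq X) :=
  uniq s /\ forall x y, x \in s -> y \in s -> bowen_ball T n x e y -> x = y.

Lemma separated_label n e (s : seq X) k (p : X -> 'I_k) : separated n e s ->
  (forall x y, p x = p y -> mdist x y <= e) ->
  {in s &, injective (orbit_label T p n)}.
Proof.
move=> [us sep] pe x y xs ys xy; apply: sep => // j jn; apply: pe.
have := congr1 (fun u : {ffun 'I_n -> 'I_k} => u (Ordinal jn)) xy.
by rewrite /orbit_label !ffunE.
Qed.

Lemma maximal_separated E n e k (p : X -> 'I_k) : 0 < e ->
  (forall x y, p x = p y -> mdist x y <= e) ->
  exists s, [/\ separated n e s, forall x, x \in s -> E x &
    forall x, E x -> exists2 y, y \in s & bowen_ball T n y e x].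
Proof.
move=> e0 pe.
pose P N := `[< exists s, [/\ separated n e s, forall x, x \in s -> E x & size s = N] >].
have P0 : exists N, P N by exists 0%N; apply/asboolP; exists [::]; split.
have Pub N : P N -> (N <= #|{ffun 'I_n -> 'I_k}|)%N.
  move=> /asboolP[s [sep _ <-]].
  rewrite -(size_map (orbit_label T p n)) -(card_uniqP _); first exact: max_card.
  by rewrite map_inj_in_uniq; [exact: sep.1|exact: (separated_label sep pe)].
have [N /asboolP[s [sep sE sN]] maxN] := ex_maxnP P0 Pub.
exists s; split => // x Ex; apply: contrapT => nx.
have xs : x \notin s.
  by apply/negP => xs; apply: nx; exists x => // j _; rewrite mdistxx ltW.
have : (N.+1 <= N)%N; last by rewrite ltnn.
apply: maxN; apply/asboolP; exists (x :: s); split; last by rewrite /= sN.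
  split => [|y z]; first by rewrite /= xs sep.1.
  rewrite !inE => /predU1P[->|ys] /predU1P[->|zs] // yz.
  - by exfalso; apply: nx; exists z => // j jn; rewrite metric_sym; exact: yz.
  - by exfalso; apply: nx; exists y.
  - exact: sep.2.
by move=> y; rewrite inE => /predU1P[->|/sE].
Qed.

End bowen_entropy.

Section uniform_measure.
Context (R : realType) (X : pmetricType R) (s : seq X).
Hypothesis s_gt0 : (0 < size s)%N.

Let weight (j : 'I_(size s)) : R := (size s)%:R^-1.

Let weight_ge0 j : 0 <= weight j.
Proof. by rewrite invr_ge0. Qed.

Let weight_sum1 : \sum_j weight j = 1.
Proof. by rewrite /weight sumr_const card_ord -[LHS]mulr_natl divff// pnatr_eq0 -lt0n. Qed.

Definition uniform_seq : borel_prob X :=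
  mix (fun j => dirac_prob (tnth (in_tuple s) j)) weight_ge0 weight_sum1.

Lemma pr_uniform_seq (A : set (borel X)) : measurable A ->
  pr uniform_seq A = \sum_(j < size s) (size s)%:R^-1 * (tnth (in_tuple s) j \in A)%:R.
Proof. by move=> mA; rewrite pr_mix//; apply: eq_bigr => j _; rewrite pr_dirac. Qed.

Lemma pr_uniform_seq1 (A : set (borel X)) : measurable A -> (forall x, x \in s -> A x) ->
  pr uniform_seq A = 1.
Proof.
move=> mA sA; rewrite pr_uniform_seq// -[RHS]weight_sum1; apply: eq_bigr => j _.
by rewrite mem_set ?mulr1//; apply: sA; exact: mem_tnth.
Qed.

Lemma label_entropy_uniform_seq (I : finType) (p : X -> I) : measurable_labelling p ->
  uniq s -> {in s &, injective p} -> label_entropy uniform_seq p = log2 (size s)%:R.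
Proof.
move=> mp us pinj; apply: shannon_uniform => //; last exact: pr_labelling_sum1.
move=> i; rewrite pr_uniform_seq//.
have [[j pj]|H] := pselect (exists j, p (tnth (in_tuple s) j) = i); [right|left].
  rewrite (bigD1 j)//= mem_set// mulr1 big1 ?addr0// => l lj.
  rewrite memNset ?mulr0// => pl; move/eqP: lj; apply.
  have : tnth (in_tuple s) l = tnth (in_tuple s) j.
    by apply: pinj; rewrite ?mem_tnth//; exact: etrans pl (esym pj).
  have /tuple_uniqP inj : uniq (in_tuple s) := us; exact: inj.
by rewrite big1// => j _; rewrite memNset ?mulr0// => pj; apply: H; exists j.
Qed.

End uniform_measure.

Section variational_principle.
Context (R : realType) (X : pmetricType R) (T : X -> X).
Hypotheses (compactX : compact [set: X]) (cT : continuous T).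
Implicit Types (mu : borel_prob X).

(** The increments over [m] windows of length [q] are regrouped into [q] increments across [m]
    steps: moving the window by one adds its new end and removes its old start. *)
Lemma sum_telescope (a : nat -> R) q m :
  \sum_(j < m) (a (j + q)%N - a j) = \sum_(j < q) (a (m + j)%N - a j).
Proof.
elim: m => [|m IH]; first by rewrite big_ord0 big1// => j _; rewrite add0n subrr.
rewrite big_ord_recr/= IH.
have -> : a (m + q)%N - a m = \sum_(j < q) (a (m.+1 + j)%N - a (m + j)%N).
  rewrite -(big_mkord xpredT (fun j => a (m.+1 + j)%N - a (m + j)%N)).
  under eq_bigr do rewrite addSnnS.
  by rewrite (telescope_sumr (fun j => a (m + j)%N))// addn0.
by rewrite -big_split/=; apply: eq_bigr => j _; rewrite addrC addrA subrK.
Qed.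

(* Misiurewicz's estimate; the entropies of the windows [j, j + q[ telescope. *)
Lemma orbit_average_entropy (sigma : borel_prob X) k (p : X -> 'I_k) n q :
  measurable_labelling p ->
  q%:R * (join_entropy T sigma p n - q%:R * log2 k%:R) <=
    n.+1%:R * join_entropy T (orbit_average cT sigma n) p q.
Proof.
move=> mp.
have k0 : (0 < k)%N by rewrite (leq_trans _ (ltn_ord (p point))).
have lk0 : 0 <= log2 k%:R :> R.
  by rewrite /log2 divr_ge0// ln_ge0// ler1n.
apply: (@le_trans _ _ (\sum_(j < n.+1)
    join_entropy T (image_prob sigma (@continuous_iter R X T cT j)) p q)); last first.
  rewrite -ler_pdivrMl// mulr_sumr.
  exact: (join_entropy_mix cT _ _ _ _ mp).
apply: (@le_trans _ _ (\sum_(j < n.+1)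
    (join_entropy T sigma p (j + q) - join_entropy T sigma p j))); last first.
  by apply: ler_sum => j _; rewrite lerBlDl; exact: join_entropy_add.
rewrite (sum_telescope (fun j => join_entropy T sigma p j)).
have -> (x : R) : q%:R * x = \sum_(j < q) x by rewrite sumr_const card_ord mulr_natl.
apply: ler_sum => j _.
apply: lerB.
  by rewrite addSnnS; exact: join_entropy_mono.
apply: le_trans (join_entropy_le cT sigma j mp) _.
by rewrite ler_wpM2r// ler_nat ltnW.
Qed.

(** Bowen sums bounded away from zero force separated sets of size at least about [2 ^ (t n)]. The
    uniform measures on them have large entropy for every partition of diameter at most [e]; hence
    the partition with null boundary can be chosen after the limit measure [mu] is known. *)
Theorem variational_principle_ge (C : set X) (t : R) :
  closed C -> T @` C `<=` C -> 0 <= t -> (t%:E < htop T C)%E ->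
  exists mu, [/\ inv_measures T mu, pr mu C = 1 & entropy_ge T mu t].
Proof.
move=> cC TC t0 tC; have mC := measurable_closed_borel cC.
have [e [c [e0 c0 [n0 _ cP]]]] := htop_gt t0 tC.
(* This partition only bounds the sizes of separated sets, so the measure is arbitrary here. *)
have [k [p [_ [pe _]]]] := small_partition compactX (dirac_prob point) e0.
pose s n := sval (cid (maximal_separated T C n e0 pe)).
have sP n : [/\ separated T n e (s n), forall x, x \in s n -> C x &
    forall x, C x -> exists2 y, y \in s n & bowen_ball T n y e x].
  exact: svalP (cid (maximal_separated T C n e0 pe)).
have sc n : (n0 <= n)%N -> c <= (size (s n))%:R * 2 `^ (- (t * n%:R)).
  move=> nn0; have := cP n nn0; rewrite -lee_fin => /le_trans; apply.
  by have [[us _] _ cov] := sP n; exact: bowen_sum_le_size.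
(* Taking [maxn n0 n] makes the set nonempty, hence its uniform measure defined, for every [n]. *)
have s0 n : (0 < size (s (maxn n0 n)))%N.
  rewrite lt0n; apply/negP => /eqP s0; have := sc _ (leq_maxl n0 n).
  by rewrite s0 mul0r leNgt c0.
pose sigma n := uniform_seq (s0 n).
have sigmaC n : pr (sigma n) C = 1.
  by apply: pr_uniform_seq1 => //; case: (sP (maxn n0 n)).
have [mu clmu] := ex_cluster_borel_prob compactX (fun n => orbit_average cT (sigma n) n).
have [imu muC] := cluster_orbit_average compactX cC TC sigmaC clmu.
exists mu; split => //.
have [l [r [mr [re Or]]]] := small_partition compactX mu e0.
exists l, r; split => // q; rewrite leNgt; apply/negP => lt_q.
(* Half of the supposed deficit: one half is lost along the averages and the other in upper
   semicontinuity, which already contradicts the definition. *)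
pose d := (t * q%:R - join_entropy T mu r q) / 2.
have d0 : 0 < d by rewrite divr_gt0// subr_gt0.
have usc := join_entropy_usc compactX cT q imu mr Or d0.
(* All the terms of the Misiurewicz estimate that do not grow with [n]; they are absorbed by
   [n.+1 * d] for large [n]. *)
pose B := q%:R * (t + q%:R * log2 l%:R - log2 c).
have far : \forall n \near \oo, t * q%:R - d <= join_entropy T (orbit_average cT (sigma n) n) r q.
  near=> n.
  have n10 : 0 < n.+1%:R :> R by rewrite ltr0n.
  rewrite -(ler_pM2l n10); apply: le_trans (orbit_average_entropy (sigma n) n q mr).
  have Hn : t * n%:R + log2 c <= join_entropy T (sigma n) r n.
    have E : maxn n0 n = n by apply/maxn_idPr; near: n; exact: nbhs_infty_ge.
    have [sep _ _] := sP (maxn n0 n).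
    have : log2 (size (s (maxn n0 n)))%:R = join_entropy T (sigma n) r (maxn n0 n).
      rewrite join_entropyE label_entropy_uniform_seq//; [|exact: sep.1|].
        exact: measurable_orbit_label.
      exact: (separated_label sep re).
    have := sc _ (leq_maxl n0 n); rewrite E => cs <-.
    apply: (@le_trans _ _ (log2 (2 `^ (t * n%:R) * c))).
      by rewrite /log2 lnM ?posrE ?powR_gt0// ln_powR mulrDl mulfK ?gt_eqF// ln_gt0// ltr1n.
    rewrite /log2 ler_pM2r ?invr_gt0 ?ln_gt0 ?ltr1n// ler_ln ?posrE.
    - by move: cs; rewrite powRN ler_pdivlMr ?powR_gt0// mulrC.
    - by rewrite mulr_gt0// powR_gt0.
    - by rewrite ltr0n -E.
  have : q%:R * (t * n%:R + log2 c - q%:R * log2 l%:R) <=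
      q%:R * (join_entropy T (sigma n) r n - q%:R * log2 l%:R).
    by rewrite ler_wpM2l// lerD2r.
  apply: le_trans.
  have Bn : B <= n.+1%:R * d.
    rewrite -ler_pdivrMr// ltW// (@lt_trans _ _ n%:R) ?ltr_nat//.
    by near: n; exact: nbhs_infty_gtr.
  by move: Bn; rewrite /B -natr1; lra.
have [nu [] /=] := clmu [set nu | t * q%:R - d <= join_entropy T nu r q] _ far usc.
by rewrite /d; lra.
Unshelve. all: by end_near. Qed.

End variational_principle.

(** * Transitive points *)

Section transitive_points.
Context (R : realType) (X : pmetricType R) (T : X -> X).
Hypotheses (compactX : compact [set: X]) (cT : continuous T).
Implicit Types (x y : X) (U C D : set X) (mu : borel_prob X).

Lemma iter_invariant C x n : T @` C `<=` C -> C x -> C (iter n T x).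
Proof. by move=> TC Cx; elim: n => //= n IH; apply: TC; exists (iter n T x). Qed.

(** The omega-limit set of a point of [C] stays in [C]. *)
Lemma Tran_closed C x : Tran T x -> closed C -> T @` C `<=` C -> C x -> C = setT.
Proof.
move=> Tx cC TC Cx; apply/seteqP; split => // y _; apply: cC => B By.
have : omega_limit T x y by rewrite Tx.
by apply => //; apply: (@filterE _ \oo) => n /=; exact: iter_invariant.
Qed.

Lemma Tran_visit x U y : Tran T x -> nbhs y U -> exists2 n, (0 < n)%N & U (iter n T x).
Proof.
move=> Tx Uy; have : omega_limit T x y by rewrite Tx.
move=> /(_ [set z | exists2 n, (0 < n)%N & z = iter n T x] U _ Uy)[].
  by exists 1%N => // n /= n0; exists n.
by move=> z [[n n0 zE] Un]; exists n => //; rewrite -zE.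
Qed.

Lemma open_mdist_lt x (e : R) : open [set y | mdist x y < e].
Proof.
apply: (@open_comp _ _ (mdist x) [set z | z < e]); last exact: open_lt.
by move=> y _; exact: continuous_mdist.
Qed.

(** The expected number of visits in [l] steps is [l] times the mass of [U], so not all orbits can
    fall below half of it. The expectation is a finite sum over the visit patterns [b]. *)
Lemma ex_frequent_orbit mu U l : inv_measures T mu -> open U -> 0 < pr mu U -> (0 < l)%N ->
  exists y, l%:R * (pr mu U / 2) <= (\sum_(j < l | `[< U (iter j T y) >]) 1)%N%:R.
Proof.
move=> imu oU U0 l0; have mU := measurable_open_borel oU.
apply: contrapT => /forallNP H.
have {}H y : (\sum_(j < l | `[< U (iter j T y) >]) 1)%N%:R < l%:R * (pr mu U / 2).
  by rewrite ltNge; apply/negP; exact: H.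
pose b y : {ffun 'I_l -> bool} := [ffun j : 'I_l => `[< U (iter j T y) >]].
have mb : measurable_labelling b.
  apply: measurable_labelling_ffun => j; have mj := measurable_iter cT j mU; case.
    rewrite (_ : _ @^-1` _ = iter j T @^-1` U)//.
    by apply/seteqP; split => y /= => [/asboolP|Uy]//; exact/asboolP.
  rewrite (_ : _ @^-1` _ = ~` (iter j T @^-1` U)); first exact: measurableC.
  by apply/seteqP; split => y /= Uy; [apply/asboolPn; rewrite Uy|exact: asboolF].
have E : l%:R * pr mu U = \sum_(w : {ffun 'I_l -> bool})
    (\sum_(j < l | w j) 1)%N%:R * pr mu (b @^-1` [set w]).
  transitivity (\sum_(j < l) \sum_(w : {ffun 'I_l -> bool} | w j) pr mu (b @^-1` [set w])).
    rewrite (eq_bigr (fun=> pr mu U)) => [|j _].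
      by rewrite sumr_const card_ord mulr_natl.
    rewrite -(@pr_labelling_pred _ _ mu _ b (fun w : {ffun 'I_l -> bool} => w j))//.
    rewrite -(inv_measures_pr cT j imu mU); congr pr.
    by apply/seteqP; split => y /=; rewrite ffunE => /asboolP.
  under eq_bigr do rewrite big_mkcond.
  rewrite exchange_big/=; apply: eq_bigr => w _.
  rewrite -big_mkcond/= natr_sum mulr_suml; apply: eq_bigr => j _.
  by rewrite mul1r.
have : l%:R * pr mu U <= l%:R * (pr mu U / 2).
  have -> : l%:R * (pr mu U / 2) = \sum_w l%:R * (pr mu U / 2) * pr mu (b @^-1` [set w]).
    by rewrite -mulr_sumr (pr_labelling_sum1 mu mb) mulr1.
  rewrite E; apply: ler_sum => w _.
  have [[y by_]|nw] := pselect (exists y, b y = w).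
    rewrite ler_wpM2r ?pr_ge0//; apply: le_trans _ (ltW (H y)).
    rewrite le_eqVlt; apply/orP; left; apply/eqP; congr _%:R.
    by apply: eq_bigl => j; rewrite -by_ ffunE.
  rewrite (_ : b @^-1` [set w] = set0); last first.
    by apply/seteqP; split => // y byw; apply: nw; exists y.
  by rewrite pr_set0 !mulr0.
have l0R : 0 < l%:R :> R by rewrite ltr0n.
by rewrite ler_pM2l//; lra.
Qed.

(** By openness, all points near a frequently visiting [y] repeat its visits over the whole window,
    and the orbit of [x] enters that neighbourhood. The frequency obtained is the same for all
    window lengths. *)
Lemma Tran_BR mu : inv_measures T mu -> measure_support mu = setT -> Tran T `<=` BR T.
Proof.
move=> imu Smu x Tx e e0.
have bE : ball x e = [set y | mdist x y < e] by rewrite ballEmdist.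
have oU : open (ball x e) by rewrite bE; exact: open_mdist_lt.
have U0 : 0 < pr mu (ball x e).
  have : measure_support mu x by rewrite Smu.
  by move/measure_support_pr; apply; split => //; exact: ballxx.
apply: (@lt_le_trans _ _ (pr mu (ball x e) / 2)%:E); first by rewrite lte_fin; lra.
apply: le_ereal_inf_tmp => _ [L _ <-].
have [y yP] := ex_frequent_orbit imu oU U0 (ltn0Sn L).
have Wy : nbhs y [set z | forall j : 'I_L.+1, ball x e (iter j T y) -> ball x e (iter j T z)].
  apply: (@filter_forall _ _ (fun (j : 'I_L.+1) z =>
    ball x e (iter j T y) -> ball x e (iter j T z)) (nbhs y)) => j.
  have [Uj|Uj] := pselect (ball x e (iter j T y)); last by apply: nearW.
  have : nbhs y (iter j T @^-1` ball x e).
    by apply: (continuous_iter cT); exact: open_nbhs_nbhs.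
  by apply: filterS.
have [a a0 aW] := Tran_visit Tx Wy.
apply: le_trans (ereal_sup_ubound _); last by exists (a, L.+1) => //=.
rewrite /= lee_fin ler_pdivlMr ?ltr0n// mulrC (le_trans yP)// ler_nat.
rewrite /count_in -{1}[a]add0n big_addn addKn big_mkord.
rewrite big_mkcond [leqRHS]big_mkcond/=; apply: leq_sum => j _.
case: ifP => // /asboolP Uj; rewrite ifT//; apply/asboolP; split.
  by rewrite /= addn_gt0 a0 orbT.
by rewrite iterD; exact: aW.
Qed.

Lemma pr_empirical n x (A : set (borel X)) : measurable A ->
  pr (empirical T n x) A = n.+1%:R^-1 * \sum_(j < n.+1) (iter j T x \in A)%:R.
Proof.
move=> mA; apply: EFin_inj; rewrite -prE /= /zero_out asboolT//.
rewrite /empirical_fun /mscale /= /msum EFinM; congr (_ * _)%E.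
by rewrite -sumEFin; apply: eq_bigr => j _; exact: diracE.
Qed.

(* The point x is outside D, and if it visited all balls around itself with positive
   density then a limit measure would charge a closed ball disjoint from D. *)
Lemma Tran_notin_QW D x : Tran T x -> closed D -> T @` D `<=` D -> D <> setT ->
  (forall mu, limit_measures T x mu -> measure_support mu `<=` D) -> ~ QW T x.
Proof.
move=> Tx cD TD DT SD QWx.
have nDx : ~ D x by move=> Dx; apply: DT; exact: Tran_closed Tx cD TD Dx.
have : nbhs x (~` D) by apply: open_nbhs_nbhs; split => //; exact: closed_openC.
move=> /nbhs_ballP[e /= e0 xeD].
have e2 : 0 < e / 2 by rewrite divr_gt0.
pose B := [set y | mdist x y <= e / 2].
have cB : closed B.
  have := @continuous_closedP X R (mdist x); case=> + _.
  by move=> /(_ (@continuous_mdist _ _ x) [set r | r <= e / 2]); apply; exact: closed_le.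
have mB := measurable_closed_borel cB.
have null mu : limit_measures T x mu -> pr mu B = 0.
  move=> Mmu; apply: pr_disjoint_support => //; apply/seteqP; split => // y [By Sy].
  apply: (xeD y); last exact: SD Sy.
  by rewrite ballEmdist /=; move: By; rewrite /B /=; lra.
have := QWx _ e2; rewrite /upper_density limn_esup_lim.
rewrite (cvg_lim _ (@cvg_esups_inf _ _))// => dens.
have [c c0 cd] : exists2 c : R, 0 < c & (c%:E < ereal_inf (range (esups
    (fun n => ((count_in (visits T x (ball x (e / 2))) 0 n)%:R / n%:R)%:E))))%E.
  move: dens; case: (ereal_inf _) => [r|_|//].
    by rewrite lte_fin => r0; exists (r / 2); rewrite ?lte_fin; lra.
  by exists 1 => //; rewrite ltry.
have freq N : exists n, (N <= n)%N /\ c <= pr (empirical T n x) B.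
  have : (c%:E < esups (fun n =>
      ((count_in (visits T x (ball x (e / 2))) 0 n)%:R / n%:R)%:E) N.+1)%E.
    by apply: lt_le_trans cd _; apply: ereal_inf_lbound; exists N.+1.
  (* The tail starting at [N.+1] excludes length 0, and a length [m.+1] matches the indexing of
     [empirical]. *)
  move=> /ereal_sup_gt[_ [[//|m] /= Nm <-]]; rewrite lte_fin => cm; exists m; split => //.
  apply: le_trans (ltW cm) _; rewrite pr_empirical// mulrC ler_wpM2l//.
  rewrite /count_in add0n big_mkord natr_sum big_mkcond; apply: ler_sum => j _.
  case: ifP => [/asboolP[_ xj]|_]; last exact: ler0n.
  rewrite mem_set//; move: xj; rewrite ballEmdist /B /=; exact: ltW.
pose n N := sval (cid (freq N)).
have nP N : (N <= n N)%N /\ c <= pr (empirical T (n N) x) B by exact: svalP (cid (freq N)).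
have [mu clmu] := ex_cluster_borel_prob compactX (fun N => empirical T (n N) x).
(* A cluster point along the times [n N], which are at least [N], is a cluster point of the full
   sequence. *)
have Mmu : limit_measures T x mu.
  move=> A A' [N _ AN] A'mu; apply: clmu => //.
  exists N => // k /= Nk; apply: AN => /=; exact: leq_trans Nk (nP k).1.
have usc : \forall nu \near mu, pr nu B < c by apply: pr_usc => //; rewrite null.
have [nu [/= cnu]] := clmu [set nu | c <= pr nu B] _ (@filterE _ \oo _ _ (fun k => (nP k).2)) usc.
by rewrite ltNge cnu.
Qed.

End transitive_points.

(** * Paths of mixtures and the gaps *)

Section clamp.
Context (R : realType).
Implicit Types (s : R).

(** Clamping keeps the weights nonnegative for every real [s], so the path of mixtures is defined on
    the whole line. At most one of [clamp s] and [clamp (- s)] is nonzero, which selects one of the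
    two segments. *)
Definition clamp s : R := Num.max 0 (Num.min 1 s).

Lemma clamp_ge0 s : 0 <= clamp s.
Proof. by rewrite le_max lexx. Qed.

Lemma clamp_id s : 0 <= s -> s <= 1 -> clamp s = s.
Proof. by move=> s0 s1; rewrite /clamp; move/min_idPr : s1 => ->; exact/max_idPr. Qed.

Lemma clamp_le0 s : s <= 0 -> clamp s = 0.
Proof.
move=> s0; rewrite /clamp; have /min_idPr -> : s <= 1 by rewrite (le_trans s0).
exact/max_idPl.
Qed.

Lemma clamp_le1 s : clamp s <= 1.
Proof. by rewrite ge_max ler01 ge_min lexx. Qed.

Lemma clamp_disjoint s : clamp s = 0 \/ clamp (- s) = 0.
Proof.
have [s0|s0] := leP s 0; first by left; exact: clamp_le0.
by right; apply: clamp_le0; rewrite oppr_le0 ltW.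
Qed.

Lemma clampD_le1 s : clamp s + clamp (- s) <= 1.
Proof. by case: (clamp_disjoint s) => ->; rewrite ?add0r ?addr0 clamp_le1. Qed.

Lemma continuous_clamp : continuous clamp.
Proof.
move=> s; apply: continuous_max; first exact: cvg_cst.
by apply: continuous_min; [exact: cvg_cst|exact: cvg_id].
Qed.

End clamp.

Section paths_of_mixtures.
Context (R : realType) (X : pmetricType R) (T : X -> X).
Hypotheses (compactX : compact [set: X]) (cT : continuous T).
Hypotheses (saturatedT : transitively_convex_saturated T) (Tran_BR : Tran T `<=` BR T).
Variables (m : 'I_3 -> borel_prob X) (C : 'I_3 -> set X) (t : R).
Hypotheses (inv_m : forall i, inv_measures T (m i)) (closedC : forall i, closed (C i)).
Hypotheses (TC : forall i, T @` C i `<=` C i) (mC : forall i, pr (m i) (C i) = 1).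
Hypothesis disjointC : forall i j, i != j -> C i `&` C j = set0.
Hypothesis entropy_m : forall i, entropy_ge T (m i) t.

Variables (v0 v1 v2 : 'I_3 -> R).
Hypotheses (v0_ge0 : forall i, 0 <= v0 i) (v0_sum1 : \sum_i v0 i = 1).
Hypotheses (v1_ge0 : forall i, 0 <= v1 i) (v1_sum1 : \sum_i v1 i = 1).
Hypotheses (v2_ge0 : forall i, 0 <= v2 i) (v2_sum1 : \sum_i v2 i = 1).

(* The broken line v2, v0, v1 in the simplex, parametrized by [-1, 1]. *)
Definition path_weight (s : R) (i : 'I_3) : R :=
  (1 - clamp s - clamp (- s)) * v0 i + clamp s * v1 i + clamp (- s) * v2 i.

Let path_weight_ge0 s i : 0 <= path_weight s i.
Proof.
rewrite /path_weight !addr_ge0// mulr_ge0 ?clamp_ge0//.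
by have := clampD_le1 s; lra.
Qed.

Let path_weight_sum1 s : \sum_i path_weight s i = 1.
Proof.
by rewrite /path_weight !big_split/= -!mulr_sumr v0_sum1 v1_sum1 v2_sum1 !mulr1; ring.
Qed.

Definition path_measure (s : R) : borel_prob X := mix m (path_weight_ge0 s) (path_weight_sum1 s).

Let I : set R := [set s | -1 <= s <= 1].

Definition path_set : set (borel_prob X) := path_measure @` I.

Let continuous_path_measure : continuous path_measure.
Proof.
move=> s; apply: borel_prob_cvgP => f cf.
have -> : integ (path_measure s) f = \sum_i path_weight s i * integ (m i) f.
  exact: integ_mix.
have -> : (integ nu f @[nu --> path_measure r @[r --> s]]) =
    ((\sum_i path_weight r i * integ (m i) f) @[r --> s]).
  by congr (fmap _ (nbhs s)); apply/funext => r /=; exact: integ_mix.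
apply: cvg_sumr => i; apply: cvgM; last exact: cvg_cst.
have cp : clamp r @[r --> s] --> clamp s by exact: continuous_clamp.
have cq : clamp (- r) @[r --> s] --> clamp (- s).
  apply: (@continuous_comp _ _ _ (fun r : R => - r) (@clamp R)); first exact: opp_continuous.
  exact: continuous_clamp.
apply: cvgD; last by apply: cvgM; [exact: cq|exact: cvg_cst].
apply: cvgD; last by apply: cvgM; [exact: cp|exact: cvg_cst].
apply: cvgM; last exact: cvg_cst.
by apply: cvgB => //; apply: cvgB => //; exact: cvg_cst.
Qed.

Let I_itv : I = `[-1, 1]%classic.
Proof. by apply/seteqP; split => s /=; rewrite in_itv. Qed.

Let inv_path s : inv_measures T (path_measure s).
Proof.
move=> A mA; rewrite !prE !pr_mix//; last exact: measurable_preimage.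
congr EFin; apply: eq_bigr => i _; congr (_ * _).
exact: (inv_measures_pr cT 1 (inv_m i) mA).
Qed.

Lemma saturated_path : saturated_set T path_set !=set0 /\
  (t%:E <= htop T (saturated_set T path_set))%E.
Proof.
have cpath : {within I, continuous path_measure} by exact: continuous_subspaceT.
have [|||||G0 ->] := saturatedT (K := path_set).
- by exists (path_measure 0), 0 => //; apply/andP; split; lra.
- apply: continuous_compact => //; rewrite I_itv; exact: segment_compact.
- apply: connected_continuous_connected => //; rewrite I_itv; exact: segment_connected.
- by move=> _ [s _ <-]; exact: inv_path.
- exists 3%N, m; split => // _ [s _ <-]; exists (path_weight s); split.
  + exact: path_weight_ge0.
  + exact: path_weight_sum1.
  + move=> A mA; rewrite prE pr_mix// -sumEFin; apply: eq_bigr => i _.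
    by rewrite EFinM -prE.
split => //; apply: le_ereal_inf_tmp => _ [_ [s _ <-] <-].
apply: metric_entropy_ge => //; exact: entropy_ge_mix.
Qed.

Let S i := measure_support (m i).

Let S_sub i : S i `<=` C i.
Proof. exact: measure_support_sub. Qed.

Let S_mem (P : set 'I_3) i x : S i x -> (\bigcup_(j in P) S j) x -> P i.
Proof.
move=> Six [j Pj Sjx]; have [->//|/disjointC ij] := eqVneq i j.
have : (C i `&` C j) x by split; exact: S_sub.
by rewrite ij.
Qed.

Let support_path s : measure_support (path_measure s) =
  \bigcup_(i in [set i | 0 < path_weight s i]) S i.
Proof. exact: measure_support_mix. Qed.

Let closed_bigS (P : set 'I_3) : closed (\bigcup_(i in P) S i).
Proof.
rewrite (_ : \bigcup_(i in P) S i = \big[setU/set0]_(i <- enum 'I_3 | `[< P i >]) S i).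
  by rewrite -big_filter; apply: closed_bigsetU => i _; exact: closed_measure_support.
rewrite -big_filter -bigcup_seq; apply/seteqP; split => x [i /= Pi Six]; exists i => //=.
  by rewrite mem_filter mem_enum andbT; exact/asboolP.
by move: Pi; rewrite mem_filter => /andP[/asboolP].
Qed.

(** The vertices used somewhere along the path. Their supports make up C_x, since a finite union of
    closed sets is closed. *)
Definition charged : set 'I_3 := [set i | exists2 s, I s & 0 < path_weight s i].

Variable (x : X).
Hypothesis satx : saturated_set T path_set x.

Let center : measure_center T x = \bigcup_(i in charged) S i.
Proof.
rewrite /measure_center satx.2.
rewrite [X in closure X](_ : _ = \bigcup_(i in charged) S i).
  by apply/esym/closure_id; exact: closed_bigS.
apply/seteqP; split => y.
  move=> [_ [s Is <-]]; rewrite support_path => -[i /= wi Siy].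
  by exists i => //; exists s.
move=> [i [s Is wi] Siy]; exists (path_measure s); first by exists s.
by rewrite support_path; exists i.
Qed.

Let support_eq s : I s -> measure_support (path_measure s) = measure_center T x <->
  (forall i, charged i -> 0 < path_weight s i).
Proof.
move=> Is; rewrite center support_path; split => [E i ci|H].
  have [y Siy] := measure_support_neq0 compactX (m i).
  by apply: (@S_mem [set i | 0 < path_weight s i] i y) => //; rewrite E; exists i.
apply/seteqP; split => y [i /= wi Siy]; exists i => //=; first by exists s.
exact: H.
Qed.

Hypothesis C_neqT : \bigcup_i C i <> setT.

Lemma path_BRsharp : BRsharp T x.
Proof.
split; first exact: Tran_BR satx.1.
apply: (Tran_notin_QW compactX satx.1 (D := \bigcup_i C i)) => //.
- rewrite (_ : \bigcup_i C i = \big[setU/set0]_(i <- enum 'I_3) C i).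
    by apply: closed_bigsetU => i _; exact: closedC.
  rewrite -bigcup_seq; apply/seteqP; split => y [i _ Ciy]; exists i => //=.
  exact: mem_enum.
- by move=> _ [y [i _ Ciy] <-]; exists i => //; apply: TC; exists y.
- rewrite satx.2 => _ [s _ <-]; rewrite support_path => y [i _ Siy].
  by exists i => //; exact: S_sub.
Qed.

Lemma path_Wsharp : (forall s i, I s -> charged i -> 0 < path_weight s i) -> Wsharp T x.
Proof.
move=> H; split; first exact: path_BRsharp.
by rewrite satx.2 => _ [s Is <-]; apply/support_eq => // i; exact: H.
Qed.

Lemma path_notWsharp s i : I s -> charged i -> path_weight s i = 0 -> ~ Wsharp T x.
Proof.
move=> Is ci w0 [_]; rewrite satx.2 => /(_ (path_measure s)) H.
have /support_eq - /(_ Is i ci) : measure_support (path_measure s) = measure_center T x.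
  by apply: H; exists s.
by rewrite w0 ltxx.
Qed.

Lemma path_Vsharp s : I s -> (forall i, charged i -> 0 < path_weight s i) -> Vsharp T x.
Proof.
move=> Is H; split; first exact: path_BRsharp.
by exists (path_measure s); [rewrite satx.2; exists s|exact/support_eq].
Qed.

Lemma path_notVsharp : (forall s, I s -> exists2 i, charged i & path_weight s i = 0) ->
  ~ Vsharp T x.
Proof.
move=> H [_ [nu]]; rewrite satx.2 => -[s Is <-] /(support_eq Is) E.
by have [i /E wi w0] := H s Is; rewrite w0 ltxx in wi.
Qed.

Lemma path_Ssharp i : (forall s, I s -> 0 < path_weight s i) -> Ssharp T x.
Proof.
move=> H; have [y Siy] := measure_support_neq0 compactX (m i).
exists y; rewrite satx.2 => _ [s Is <-]; rewrite support_path.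
by exists i => //=; exact: H.
Qed.

Lemma path_notSsharp : (forall i, exists2 s, I s & path_weight s i = 0) -> ~ Ssharp T x.
Proof.
move=> H [y]; rewrite satx.2 => Sy.
have : measure_support (path_measure 0) y.
  by apply: Sy; exists 0 => //; apply/andP; split; lra.
rewrite support_path => -[i _ Siy]; have [s Is w0] := H i.
have : measure_support (path_measure s) y by apply: Sy; exists s.
rewrite support_path => /(S_mem Siy) /=; by rewrite w0 ltxx.
Qed.

Let pr_path s i : pr (path_measure s) (C i) = path_weight s i.
Proof.
rewrite pr_mix; last exact: measurable_closed_borel.
rewrite (bigD1 i)//= mC mulr1 big1 ?addr0// => j ji.
suff -> : pr (m j) (C i) = 0 by rewrite mulr0.
apply: pr_disjoint_support => //; apply/seteqP; split => // y [Ciy /S_sub Cjy].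
by rewrite -(disjointC ji); split.
Qed.

Lemma path_QR : (forall s, path_weight s = path_weight 0) -> QR T x.
Proof.
move=> H; exists (path_measure 0); rewrite satx.2; apply/seteqP; split => nu.
  by move=> [s _ <-]; apply: pr_inj => A mA; rewrite !pr_mix// H.
by move=> ->; exists 0 => //; apply/andP; split; lra.
Qed.

(** The mass of [C i] recovers the weight of the vertex [i], so distinct weights give distinct
    measures. *)
Lemma path_notQR s i : I s -> path_weight s i <> path_weight 0 i -> ~ QR T x.
Proof.
move=> Is w [nu]; rewrite satx.2 => E; apply: w; rewrite -!pr_path.
have I0 : I 0 by apply/andP; split; lra.
have : [set nu] (path_measure s) by rewrite -E; exists s.
move=> /= ->; have : [set nu] (path_measure 0) by rewrite -E; exists 0.
by move=> /= ->.
Qed.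

End paths_of_mixtures.

Section gaps.
Context (R : realType) (X : pmetricType R) (T : X -> X).
Hypotheses (compactX : compact [set: X]) (cT : continuous T).
Hypotheses (saturatedT : transitively_convex_saturated T) (Tran_BR : Tran T `<=` BR T).
Variables (m : 'I_3 -> borel_prob X) (C : 'I_3 -> set X) (t : R).
Hypotheses (inv_m : forall i, inv_measures T (m i)) (closedC : forall i, closed (C i)).
Hypotheses (TC : forall i, T @` C i `<=` C i) (mC : forall i, pr (m i) (C i) = 1).
Hypothesis disjointC : forall i j, i != j -> C i `&` C j = set0.
Hypothesis entropy_m : forall i, entropy_ge T (m i) t.

Definition vec3 (a b c : R) (i : 'I_3) : R :=
  match val i with 0%N => a | 1%N => b | _ => c end.

Let o0 : 'I_3 := @Ordinal 3 0 isT.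
Let o1 : 'I_3 := @Ordinal 3 1 isT.
Let o2 : 'I_3 := @Ordinal 3 2 isT.

Let ord3P (P : 'I_3 -> Prop) : P o0 -> P o1 -> P o2 -> forall i, P i.
Proof.
by move=> P0 P1 P2 [[|[|[|//]]] i3]; rewrite (bool_irrelevance i3 isT).
Qed.

Let vec3_ge0 a b c : 0 <= a -> 0 <= b -> 0 <= c -> forall i, 0 <= vec3 a b c i.
Proof. by move=> a0 b0 c0; exact: ord3P. Qed.

Let vec3_sum1 a b c : a + b + c = 1 -> \sum_i vec3 a b c i = 1.
Proof. by move=> <-; rewrite !big_ord_recl big_ord0 /vec3 /= addr0 addrA. Qed.

(** Saturation at a constant path supplies a transitive point. If the union were everything, this
    point would lie in some [C i], forcing [C i] to be the whole space and every disjoint [C j] to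
    be empty, against its mass 1. *)
Let C_neqT : \bigcup_i C i <> setT.
Proof.
have h0 : forall i, 0 <= vec3 1 0 0 i by apply: vec3_ge0.
have h1 : \sum_i vec3 1 0 0 i = 1 by apply: vec3_sum1; rewrite !addr0.
have [[x [Tx _]] _] := saturated_path compactX cT saturatedT inv_m entropy_m h0 h1 h0 h1 h0 h1.
move=> CT; have : (\bigcup_i C i) x by rewrite CT.
move=> [i _ Cix]; have CiT := Tran_closed Tx (@closedC i) (@TC i) Cix.
have [j ij] : exists j, i != j.
  by move: i {Cix CiT}; apply: ord3P; [exists o1|exists o0|exists o0].
have : pr (m j) (C j) = 0.
  by rewrite -(setTI (C j)) -CiT disjointC// pr_set0.
by rewrite mC => /eqP; rewrite oner_eq0.
Qed.

Let gap_of v0 v1 v2 (h0 : forall i, 0 <= v0 i) (s0 : \sum_i v0 i = 1)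
    (h1 : forall i, 0 <= v1 i) (s1 : \sum_i v1 i = 1)
    (h2 : forall i, 0 <= v2 i) (s2 : \sum_i v2 i = 1) (A : set X) :
  saturated_set T (path_set m h0 s0 h1 s1 h2 s2) `<=` A ->
  (t%:E <= htop T (A `&` Tran T))%E.
Proof.
move=> sA.
have [_ /le_trans] := saturated_path compactX cT saturatedT inv_m entropy_m h0 s0 h1 s1 h2 s2.
by apply; apply: le_htop => x sx; split; [exact: sA|case: sx].
Qed.

Let clamp1 : clamp 1 = 1 :> R. Proof. by rewrite clamp_id. Qed.
Let clampN1 : clamp (- 1) = 0 :> R. Proof. by rewrite clamp_le0. Qed.
Let clamp0 : clamp 0 = 0 :> R. Proof. by rewrite clamp_le0. Qed.
Let clamp_half : clamp (1 / 2) = 1 / 2 :> R. Proof. by rewrite clamp_id; lra. Qed.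
Let clampN_half : clamp (- (1 / 2)) = 0 :> R. Proof. by rewrite clamp_le0; lra. Qed.

Ltac weights := rewrite /path_weight /vec3 /=
  ?opprK ?oppr0 ?clamp1 ?clampN1 ?clamp0 ?clamp_half ?clampN_half.

Ltac bounds s := move: (clamp_ge0 s) (clamp_ge0 (- s)) (clampD_le1 s).

(** A constant path at one vertex gives a single limit measure. *)
Lemma gap_QR_BR1 : (t%:E <= htop T (((QR T `&` BR1 T) `\` set0) `&` Tran T))%E.
Proof.
have h0 : forall i, 0 <= vec3 1 0 0 i by apply: vec3_ge0.
have s0 : \sum_i vec3 1 0 0 i = 1 by apply: vec3_sum1; rewrite !addr0.
apply: (gap_of (h0 := h0) (s0 := s0) (h1 := h0) (s1 := s0) (h2 := h0) (s2 := s0)).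
have const s : path_weight (vec3 1 0 0) (vec3 1 0 0) (vec3 1 0 0) s = vec3 1 0 0.
  by apply/funext; apply: ord3P; weights; lra.
move=> x sx; split => //; split.
  by apply: (path_QR sx) => s; rewrite !const.
apply: (path_Wsharp compactX Tran_BR closedC TC mC disjointC sx C_neqT) => s i _ [r _].
by rewrite !const.
Qed.

(** Along a segment interior to one edge the support is constant while the weights vary. *)
Lemma gap_BR1_QR : (t%:E <= htop T ((BR1 T `\` (QR T `&` BR1 T)) `&` Tran T))%E.
Proof.
have h0 : forall i, 0 <= vec3 (2 / 3) (1 / 3) 0 i by apply: vec3_ge0; lra.
have s0 : \sum_i vec3 (2 / 3) (1 / 3) 0 i = 1 by apply: vec3_sum1; lra.
have h1 : forall i, 0 <= vec3 (1 / 3) (2 / 3) 0 i by apply: vec3_ge0; lra.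
have s1 : \sum_i vec3 (1 / 3) (2 / 3) 0 i = 1 by apply: vec3_sum1; lra.
apply: (gap_of (h0 := h0) (s0 := s0) (h1 := h1) (s1 := s1) (h2 := h0) (s2 := s0)).
move=> x sx; split.
  apply: (path_Wsharp compactX Tran_BR closedC TC mC disjointC sx C_neqT) => s i _ [r _].
  move: i; apply: ord3P; weights; bounds s; lra.
case=> + _; apply: (path_notQR compactX closedC mC disjointC sx (s := 1) (i := o0)).
  by apply/andP; split; lra.
by weights; lra.
Qed.

(** The path runs from a vertex to the middle of an edge: the starting vertex is always charged, but
    the second one is not charged at the start. *)
Lemma gap_BR2_BR1 : (t%:E <= htop T ((BR2 T `\` BR1 T) `&` Tran T))%E.
Proof.
have h0 : forall i, 0 <= vec3 1 0 0 i by apply: vec3_ge0.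
have s0 : \sum_i vec3 1 0 0 i = 1 by apply: vec3_sum1; lra.
have h1 : forall i, 0 <= vec3 (1 / 2) (1 / 2) 0 i by apply: vec3_ge0; lra.
have s1 : \sum_i vec3 (1 / 2) (1 / 2) 0 i = 1 by apply: vec3_sum1; lra.
apply: (gap_of (h0 := h0) (s0 := s0) (h1 := h1) (s1 := s1) (h2 := h0) (s2 := s0)).
have I1 : [set s : R | -1 <= s <= 1] 1 by apply/andP; split; lra.
have I0 : [set s : R | -1 <= s <= 1] 0 by apply/andP; split; lra.
move=> x sx; split; [split|].
- apply: (path_Vsharp compactX Tran_BR closedC TC mC disjointC sx C_neqT I1) => i [r _].
  by move: i; apply: ord3P; weights; bounds r; lra.
- by apply: (path_Ssharp compactX sx (i := o0)) => s _; weights; bounds s; lra.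
- apply: (path_notWsharp compactX closedC mC disjointC sx (i := o1) I0).
    by exists 1 => //; weights; lra.
  by weights; lra.
Qed.

(** A whole edge: its interior points charge both vertices, while its ends have disjoint
    supports. *)
Lemma gap_BR3_BR2 : (t%:E <= htop T ((BR3 T `\` BR2 T) `&` Tran T))%E.
Proof.
have h0 : forall i, 0 <= vec3 1 0 0 i by apply: vec3_ge0.
have s0 : \sum_i vec3 1 0 0 i = 1 by apply: vec3_sum1; lra.
have h1 : forall i, 0 <= vec3 0 1 0 i by apply: vec3_ge0.
have s1 : \sum_i vec3 0 1 0 i = 1 by apply: vec3_sum1; lra.
apply: (gap_of (h0 := h0) (s0 := s0) (h1 := h1) (s1 := s1) (h2 := h0) (s2 := s0)).
have I1 : [set s : R | -1 <= s <= 1] 1 by apply/andP; split; lra.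
have I0 : [set s : R | -1 <= s <= 1] 0 by apply/andP; split; lra.
have Ih : [set s : R | -1 <= s <= 1] (1 / 2) by apply/andP; split; lra.
move=> x sx; split.
  apply: (path_Vsharp compactX Tran_BR closedC TC mC disjointC sx C_neqT Ih) => i [r _].
  by move: i; apply: ord3P; weights; bounds r; lra.
case=> _; apply: (path_notSsharp closedC mC disjointC sx).
by apply: ord3P; [exists 1|exists 0|exists 0] => //; weights; lra.
Qed.

(** Two half edges issuing from the vertex [o0]: this vertex is always charged, the other two never
    together. *)
Lemma gap_BR4_BR3 : (t%:E <= htop T ((BR4 T `\` BR3 T) `&` Tran T))%E.
Proof.
have h0 : forall i, 0 <= vec3 1 0 0 i by apply: vec3_ge0.
have s0 : \sum_i vec3 1 0 0 i = 1 by apply: vec3_sum1; lra.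
have h1 : forall i, 0 <= vec3 (1 / 2) (1 / 2) 0 i by apply: vec3_ge0; lra.
have s1 : \sum_i vec3 (1 / 2) (1 / 2) 0 i = 1 by apply: vec3_sum1; lra.
have h2 : forall i, 0 <= vec3 (1 / 2) 0 (1 / 2) i by apply: vec3_ge0; lra.
have s2 : \sum_i vec3 (1 / 2) 0 (1 / 2) i = 1 by apply: vec3_sum1; lra.
apply: (gap_of (h0 := h0) (s0 := s0) (h1 := h1) (s1 := s1) (h2 := h2) (s2 := s2)).
have I1 : [set s : R | -1 <= s <= 1] 1 by apply/andP; split; lra.
have IN1 : [set s : R | -1 <= s <= 1] (- 1) by apply/andP; split; lra.
move=> x sx; split.
  right; split; first exact: (path_BRsharp compactX Tran_BR closedC TC mC sx C_neqT).
  by apply: (path_Ssharp compactX sx (i := o0)) => s _; weights; bounds s; lra.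
apply: (path_notVsharp compactX closedC mC disjointC sx) => s _.
case: (clamp_disjoint s) => cs.
  by exists o1; [exists 1 => //; weights; lra|rewrite /path_weight /vec3 /= cs; lra].
by exists o2; [exists (- 1) => //; weights; lra|rewrite /path_weight /vec3 /= cs; lra].
Qed.

(** Two full edges meeting at [o1]: no mixture charges all three vertices, and each vertex is missed
    somewhere. *)
Lemma gap_BR5_BR4 : (t%:E <= htop T ((BR5 T `\` BR4 T) `&` Tran T))%E.
Proof.
have h0 : forall i, 0 <= vec3 0 1 0 i by apply: vec3_ge0.
have s0 : \sum_i vec3 0 1 0 i = 1 by apply: vec3_sum1; lra.
have h1 : forall i, 0 <= vec3 1 0 0 i by apply: vec3_ge0.
have s1 : \sum_i vec3 1 0 0 i = 1 by apply: vec3_sum1; lra.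
have h2 : forall i, 0 <= vec3 0 0 1 i by apply: vec3_ge0.
have s2 : \sum_i vec3 0 0 1 i = 1 by apply: vec3_sum1; lra.
apply: (gap_of (h0 := h0) (s0 := s0) (h1 := h1) (s1 := s1) (h2 := h2) (s2 := s2)).
have I1 : [set s : R | -1 <= s <= 1] 1 by apply/andP; split; lra.
have I0 : [set s : R | -1 <= s <= 1] 0 by apply/andP; split; lra.
have IN1 : [set s : R | -1 <= s <= 1] (- 1) by apply/andP; split; lra.
move=> x sx; split; first exact: (path_BRsharp compactX Tran_BR closedC TC mC sx C_neqT).
case=> [|[_]].
  apply: (path_notVsharp compactX closedC mC disjointC sx) => s _.
  case: (clamp_disjoint s) => cs.
    by exists o0; [exists 1 => //; weights; lra|rewrite /path_weight /vec3 /= cs; lra].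
  by exists o2; [exists (- 1) => //; weights; lra|rewrite /path_weight /vec3 /= cs; lra].
apply: (path_notSsharp closedC mC disjointC sx).
by apply: ord3P; [exists 0|exists 1|exists 0] => //; weights; lra.
Qed.

End gaps.

(** * Disjoint invariant sets of large entropy *)

Section entropy_dense_systems.
Context (R : realType) (X : pmetricType R) (T : X -> X).
Hypotheses (compactX : compact [set: X]) (cT : continuous T).
Hypotheses (denseT : entropy_dense T) (not_uniquely_ergodicT : ~ uniquely_ergodic T).

Let pair_weight (d : R) (b : bool) : R := if b then d else 1 - d.

Lemma ex_distinct_invariant mu : inv_measures T mu ->
  exists2 nu, inv_measures T nu & nu <> mu.
Proof.
move=> imu; apply: contrapT => H; apply: not_uniquely_ergodicT; exists mu.
apply/seteqP; split => nu; last by move=> ->.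
by move=> inu; apply: contrapT => numu; apply: H; exists nu.
Qed.

(* Entropy density turns three nearby mixtures of two invariant measures into
   invariant sets; a common point of two of them would carry, by Krylov-Bogoliubov,
   an invariant measure in two disjoint neighbourhoods. *)
Lemma ex_disjoint_invariant_sets (s t : R) : 0 <= t -> t < s ->
  (s%:E < htop T setT)%E ->
  exists (m : 'I_3 -> borel_prob X) (C : 'I_3 -> set X),
    [/\ forall i, inv_measures T (m i), forall i, closed (C i),
        forall i, T @` C i `<=` C i,
        (forall i, pr (m i) (C i) = 1) /\ (forall i j, i != j -> C i `&` C j = set0) &
        forall i, entropy_ge T (m i) t].
Proof.
move=> t0 ts sT.
have s0 : 0 <= s by lra.
have [mu [imu _ [k [p [mp hp]]]]] := variational_principle_ge compactX cT (@closedT _)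
  (fun x _ => I) s0 sT.
have [nu inu numu] := ex_distinct_invariant imu.
have [f cf fd] : exists2 f, continuous f & integ nu f <> integ mu f.
  apply: contrapT => H; apply: numu; apply: integ_inj => // f cf.
  by apply: contrapT => fd; apply: H; exists f.
(* The share of [nu] in the three mixtures is 0, [r] or [2 r]; this [r] limits the loss [2 r s] of
   entropy to half of [s - t]. The other half is spent as the tolerance of entropy density. *)
pose r := (s - t) / (4 * s).
have sp : 0 < s by lra.
have r0 : 0 < r by rewrite divr_gt0; lra.
have rs : r * s = (s - t) / 4 by rewrite /r; field; lra.
have r4 : r <= 1 / 4 by rewrite ler_pdivrMr; lra.
pose d (i : 'I_3) : R := i%:R * r.
have i2 (i : 'I_3) : (i%:R : R) <= 2 by rewrite ler_nat -ltnS.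
have d0 i : 0 <= d i by rewrite mulr_ge0// ltW.
have d2 i : d i <= 2 * r by rewrite ler_wpM2r// ltW.
have w0 i b : 0 <= pair_weight (d i) b.
  by case: b => /=; [exact: d0|move: (d2 i); lra].
have w1 i : \sum_b pair_weight (d i) b = 1 by rewrite big_bool /=; lra.
pose pairm (b : bool) := if b then nu else mu.
pose n i := mix pairm (w0 i) (w1 i).
have inv_n i : inv_measures T (n i).
  move=> A mA; rewrite !prE !pr_mix//; last exact: measurable_preimage.
  congr EFin; apply: eq_bigr => -[] _ /=; congr (_ * _);
    [exact: (inv_measures_pr cT 1 inu mA)|exact: (inv_measures_pr cT 1 imu mA)].
pose u := (s + t) / 2.
(* The partition witnessing the entropy of [mu] serves for the mixtures; the contribution of [nu] is
   only bounded below by 0. *)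
have ent_n i : entropy_ge T (n i) u.
  exists k, p; split => // l; apply: le_trans (join_entropy_mix cT _ (w0 i) (w1 i) _ mp).
  rewrite big_bool /=; have hl := hp l; have j0 := join_entropy_ge0 T nu p l.
  have l0 : 0 <= l%:R :> R by [].
  apply: (@le_trans _ _ ((1 - d i) * (s * l%:R))); last first.
    apply: ler_wpDl; first exact: mulr_ge0.
    apply: ler_wpM2l => //.
    by move: (d2 i); lra.
  rewrite mulrA ler_wpM2r//.
  have : d i * s <= 2 * r * s by rewrite ler_wpM2r.
  by rewrite /u mulrBl mul1r -mulrA rs; lra.
pose e := integ nu f - integ mu f.
have e0 : 0 < `|e| by rewrite normr_gt0 subr_eq0; apply/eqP.
have integ_n i : integ (n i) f = integ mu f + d i * e.
  by rewrite integ_mix// big_bool /= /e; ring.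
(* The integrals of [f] against distinct mixtures differ by at least [r] times the absolute value of
   [e], so half of this as radius separates the neighbourhoods. *)
pose G i := [set m : borel_prob X | `|integ (n i) f - integ m f| < r * `|e| / 2].
have G_nbhs i : nbhs (n i) (G i).
  have := @continuous_integ R X f cf (n i) => /cvgrPdist_lt; apply.
  by rewrite divr_gt0// mulr_gt0.
have G_disj i j m : i != j -> G i m -> G j m -> False.
  move=> ij Gi Gj.
  have : r * `|e| <= `|integ (n i) f - integ (n j) f|.
    rewrite !integ_n opprD addrACA subrr add0r -mulrBl normrM ler_wpM2r//.
    rewrite /d -mulrBl normrM (gtr0_norm r0) ler_peMl ?(ltW r0)//.
    rewrite distrC.
    have [ij'|ij'] := ltnP i j.
      by rewrite -natrB ?(ltnW ij')// ger0_norm// ler1n subn_gt0.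
    have ji : (j < i)%N by rewrite ltn_neqAle ij' andbT; apply: contra ij => /eqP/val_inj ->.
    by rewrite distrC -natrB ?(ltnW ji)// ger0_norm// ler1n subn_gt0.
  rewrite leNgt => /negP; apply.
  have -> : integ (n i) f - integ (n j) f =
    (integ (n i) f - integ m f) - (integ (n j) f - integ m f) by ring.
  apply: le_lt_trans (ler_normB _ _) _; rewrite [ltRHS]splitr; exact: ltrD.
have ut : 0 < u - t by rewrite /u; lra.
have dense i : exists L : set X,
    [/\ closed L, T @` L `<=` L, forall m, inv_measures T m -> measure_support m `<=` L -> G i m
      & (t%:E < htop T L)%E].
  have [L [cL TL GL hL]] := denseT (inv_n i) (G_nbhs i) ut; exists L.
  split; [exact: cL|exact: TL|exact: GL|].
  apply: le_lt_trans hL; rewrite [t in leLHS](_ : _ = u - (u - t)); last by ring.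
  by rewrite EFinB leeB//; exact: metric_entropy_ge.
pose C i := sval (cid (dense i)).
have CP i : [/\ closed (C i), T @` C i `<=` C i,
    forall m, inv_measures T m -> measure_support m `<=` C i -> G i m
    & (t%:E < htop T (C i))%E] by exact: svalP (cid (dense i)).
have vp i : exists m, [/\ inv_measures T m, pr m (C i) = 1 & entropy_ge T m t].
  by have [cL TL _ hL] := CP i; exact: variational_principle_ge.
pose m i := sval (cid (vp i)).
have mP i : [/\ inv_measures T (m i), pr (m i) (C i) = 1 & entropy_ge T (m i) t].
  exact: svalP (cid (vp i)).
exists m, C; split; try by move=> i; case: (CP i); case: (mP i).
split; first by move=> i; case: (mP i).
move=> i j ij; have [ci Ti Gi _] := CP i; have [cj Tj Gj _] := CP j.
apply: contrapT => /eqP/set0P CC.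
have cC : closed (C i `&` C j) by exact: closedI.
have [|l [il lC]] := krylov_bogoliubov compactX cT cC _ CC.
  by move=> _ [x [xi xj] <-]; split; [apply: Ti; exists x|apply: Tj; exists x].
have Sl := measure_support_sub cC lC.
by apply: (G_disj i j l ij); [apply: Gi|apply: Gj] => // x /Sl[].
Qed.

End entropy_dense_systems.

(** Testing against nonnegative real levels covers an infinite [x] as well, and matches the
    condition [0 <= t] in the definition of Bowen entropy. *)
Lemma ereal_le_of_lt (R : realType) (x y : \bar R) : (0 <= y)%E ->
  (forall t : R, 0 <= t -> (t%:E < x)%E -> (t%:E <= y)%E) -> (x <= y)%E.
Proof.
move=> y0 H; rewrite leNgt; apply/negP => yx.
have [t [yt tx]] : exists t : R, (y < t%:E)%E /\ (t%:E < x)%E.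
  move: x y y0 yx {H} => [x| |] [y| |]//= y0; rewrite ?lte_fin => yx.
  - by exists ((x + y) / 2); rewrite !lte_fin; lra.
  - by exists (y + 1); rewrite ltry lte_fin; split => //; lra.
have t0 : 0 <= t by rewrite -lee_fin (le_trans y0)// ltW.
by have := H t t0 tx; rewrite leNgt yt.
Qed.

Unset Implicit Arguments.

Theorem theorem2 (R : realType) (X : pmetricType R) (T : X -> X)
  (compactX : compact [set: X]) (continuousT : continuous T)
  (saturatedT : transitively_convex_saturated T)
  (denseT : entropy_dense T)
  (not_uniquely_ergodicT : ~ uniquely_ergodic T)
  (full_supportT : exists2 mu, inv_measures T mu & measure_support mu = [set: X]) :
  full_entropy_gaps T
    [:: set0; QR T `&` BR1 T; BR1 T; BR2 T; BR3 T; BR4 T; BR5 T] (Tran T).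
Proof.
have [mu imu Smu] := full_supportT.
have TB := Tran_BR continuousT imu Smu.
have gap Z1 Z2 : (forall t (m : 'I_3 -> borel_prob X) (C : 'I_3 -> set X),
    (forall i, inv_measures T (m i)) -> (forall i, closed (C i)) ->
    (forall i, T @` C i `<=` C i) -> (forall i, pr (m i) (C i) = 1) ->
    (forall i j, i != j -> C i `&` C j = set0) -> (forall i, entropy_ge T (m i) t) ->
    (t%:E <= htop T ((Z2 `\` Z1) `&` Tran T))%E) ->
    htop T ((Z2 `\` Z1) `&` Tran T) = htop T (Tran T).
  move=> H; apply: le_anti; apply/andP; split; first by apply: le_htop => x [].
  apply: ereal_le_of_lt => [|t t0 tT]; first exact: htop_ge0.
  (* The room between [t] and [s] pays for mixing and for entropy density. The measures are sought
     in the whole space, whose entropy is at least that of [Tran T]. *)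
  have [s [ts sT]] : exists s : R, t < s /\ (s%:E < htop T (Tran T))%E.
    move: tT; case: (htop _ _) => [h| |//]; rewrite ?lte_fin => th.
      by exists ((t + h) / 2); rewrite !lte_fin; lra.
    by exists (t + 1); rewrite ltry; split => //; lra.
  have sX : (s%:E < htop T setT)%E by apply: lt_le_trans sT _; exact: le_htop.
  have [m [C [im cC TC [mC dC] em]]] :=
    ex_disjoint_invariant_sets compactX continuousT denseT not_uniquely_ergodicT t0 ts sX.
  exact: (H t m C).
split; first by [].
case=> [|[|[|[|[|[|i]]]]]] i7; last by case: (notF i7).
- apply: (gap set0 (QR T `&` BR1 T)) => t m C.
  exact: gap_QR_BR1.
- apply: (gap (QR T `&` BR1 T) (BR1 T)) => t m C.
  exact: gap_BR1_QR.
- apply: (gap (BR1 T) (BR2 T)) => t m C.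
  exact: gap_BR2_BR1.
- apply: (gap (BR2 T) (BR3 T)) => t m C.
  exact: gap_BR3_BR2.
- apply: (gap (BR3 T) (BR4 T)) => t m C.
  exact: gap_BR4_BR3.
- apply: (gap (BR4 T) (BR5 T)) => t m C.
  exact: gap_BR5_BR4.
Qed.
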